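(* Let $(\mathcal{R},\mu)$ be a $\sigma$-finite resonant measure space, let $X$ be a rearrangement-invariant Banach function space over it and let $X'$ be its associate space. Assume that both $X$ and $X'$ have the (ACR) property. Let $\phi\colon\mathcal{R}\to\mathcal{R}$ be a power-measure-bounded mapping, let $T_\phi f=f\circ\phi$ be the composition operator, and let $T$ be the $\xi$-limit operator of its Ces\`aro means, i.e. $Tf=\xi\text{-}\lim_{n\to\infty}\frac1n\sum_{i=0}^{n-1}T_\phi^i f$ for $f\in X$. Then for every $f\in X_a$ we have $Tf\in X_a$ and $$\frac1n\sum_{i=0}^{n-1}T_\phi^i f\to Tf\quad\text{in }(X,\lVert\cdot\rVert_X)\text{ as }n\to\infty.$$
   Context: $\mathcal{M}=\mathcal{M}(\mathcal{R},\mu)$ is the set of extended complex-valued $\mu$-measurable functions on $\mathcal{R}$ (identified when equal $\mu$-a.e.), $\mathcal{M}_+$ the non-negative ones; $\lambda$ is Lebesgue measure. For $f\in\mathcal{M}$ put $f_*(s)=\mu(\{|f|>s\})$ and $f^*(t)=\inf\{s\ge0:\ f_*(s)\le t\}$, $s,t\in[0,\infty)$. A $\sigma$-finite $(\mathcal{R},\mu)$ is resonant if $\sup_{\tilde g\in\mathcal{M},\,\tilde g^*=g^*}\int_{\mathcal{R}}|f\tilde g|\,d\mu=\int_0^\infty f^*g^*\,d\lambda$ for all $f,g\in\mathcal{M}$ (equivalently, it is non-atomic, or completely atomic with all atoms of equal measure). A Banach function norm is a map $\lVert\cdot\rVert\colon\mathcal{M}\to[0,\infty]$ with $\lVert\,|f|\,\rVert=\lVert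 f\rVert$ whose restriction to $\mathcal{M}_+$ satisfies: (P1) it is absolutely homogeneous, vanishes exactly at $f=0$ a.e., and is subadditive; (P2) $f\le g$ a.e. implies $\lVert f\rVert\le\lVert g\rVert$; (P3) $f_n\uparrow f$ a.e. implies $\lVert f_n\rVert\uparrow\lVert f\rVert$; (P4) $\lVert\chi_E\rVert<\infty$ if $\mu(E)<\infty$; (P5) if $\mu(E)<\infty$ there is a finite $C_E$ with $\int_E f\,d\mu\le C_E\lVert f\rVert$ for all $f\in\mathcal{M}_+$. It is rearrangement-invariant (r.i.) if $f^*=g^*$ implies $\lVert f\rVert=\lVert g\rVert$. The corresponding space is $X=\{f\in\mathcal{M}:\lVert f\rVert_X<\infty\}$. The associate space $X'$ is defined by the same recipe from $\lVert f\rVert_{X'}=\sup_{\lVert g\rVert_X\le1}\int_{\mathcal{R}}|fg|\,d\mu$. An r.i. space $Y$ has the (ACR) property if $\lim_{t\to\infty}f^*(t)=0$ for every $f\in Y$. $X_a$ is the set of $f\in X$ with absolutely continuous norm, i.e. $\lVert f\chi_{E_k}\rVert_X\to0$ for every sequence of measurable sets with $\chi_{E_k}\to0$ $\mu$-a.e. $\xi$ on $X$ is the locally convex topology induced by the norms $|f|_\varphi=\int_0^\infty\varphi^*f^*\,d\lambda$, $\varphi\in X'$. A measurable $\phi$ is power-measure-bounded if there is $A\in(0,\infty)$ with $\mu(\phi^{-n}(E))\le A\,\mu(E)$ for all $n\ge1$ and all measurable $E$ ($\phi^{-n}(E)$ is the preimage under the $n$-fold composition $\phi^n$). Under the stated hypotheses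 the $\xi$-limit defining $Tf$ exists for every $f\in X$ and $T$ is a linear operator continuous on $(X,\xi)$ and on $(X,\lVert\cdot\rVert_X)$. *)

(* Defs.v *)
From HB Require Import structures.
From mathcomp Require Import all_boot all_order all_algebra.
From mathcomp Require Import all_classical all_reals all_analysis.
From mathcomp Require Import measurable_realfun.
From mathcomp.real_closed Require Import complex.

Set Implicit Arguments.
Unset Strict Implicit.
Unset Printing Implicit Defensive.
Import Order.TTheory GRing.Theory Num.Theory.
Import numFieldNormedType.Exports.
Local Open Scope classical_set_scope.
Local Open Scope ring_scope.

(** C together with one point at infinity, [None]. *)
Definition excomplex (R : rcfType) : Type := option R[i].
HB.instance Definition _ (R : rcfType) := Choice.copy (excomplex R) (option R[i]).

Section excomplex_theory.
Context {R : rcfType}.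
Implicit Types x y z : excomplex R.

Definition excfin (a : R[i]) : excomplex R := Some a.
Definition excinfty : excomplex R := None.

(** Infinity is absorbing for the sum.  The value of [infty - infty] is
    immaterial: members of a Banach function space are finite a.e. *)
Definition excadd x y : excomplex R :=
  match x, y with Some a, Some b => Some (a + b) | _, _ => None end.

(** With the usual convention [0 * infty = 0]. *)
Definition excmul x y : excomplex R :=
  match x, y with
  | Some a, Some b => Some (a * b)
  | Some a, None | None, Some a => if a == 0 then Some 0 else None
  | None, None => None
  end.

Fact excaddA : associative excadd.
Proof. by move=> [a|] [b|] [c|] //=; rewrite addrA. Qed.

Fact excaddC : commutative excadd.
Proof. by move=> [a|] [b|] //=; rewrite addrC. Qed.

Fact exc0add : left_id (excfin 0) excadd.
Proof. by move=> [a|] //=; rewrite add0r. Qed.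

HB.instance Definition _ :=
  GRing.isNmodule.Build (excomplex R) excaddA excaddC exc0add.

Definition excsub x y : excomplex R := x + excmul (excfin (-1)) y.

Definition excabs x : \bar R :=
  match x with Some a => (complex.Re `|a|)%:E | None => +oo%E end.

(** The inclusion of [0, +oo]; the value at [-oo] is never used. *)
Definition exc_of_ereal (r : \bar R) : excomplex R :=
  match r with EFin a => Some a%:C%C | _ => None end.

Definition excRe x : R := match x with Some a => complex.Re a | None => 0 end.
Definition excIm x : R := match x with Some a => complex.Im a | None => 0 end.

End excomplex_theory.

Section banach_function_spaces.
Context {R : realType} {d : measure_display} {S : measurableType d}.
Implicit Types f g : S -> excomplex R.

Definition excmeasurable f : Prop :=
  [/\ measurable [set x | f x = excinfty],
      measurable_fun [set: S] (excRe \o f) &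
      measurable_fun [set: S] (excIm \o f)].

Definition nnmeasurable (u : S -> \bar R) : Prop :=
  measurable_fun [set: S] u /\ (forall x, 0 <= u x)%E.

Definition excnnfun (u : S -> \bar R) : S -> excomplex R := exc_of_ereal \o u.

Definition excabsfun f : S -> \bar R := excabs \o f.

Definition excscalefun (a : R[i]) f : S -> excomplex R :=
  fun x => excmul (excfin a) (f x).

Definition excsubfun f g : S -> excomplex R := fun x => excsub (f x) (g x).

Definition charfun (E : set S) : S -> \bar R := fun x => (\1_E x)%:E.

Definition excrestr f (E : set S) : S -> excomplex R :=
  fun x => excmul (f x) (excnnfun (charfun E) x).

Variable mu : {measure set S -> \bar R}.

Definition distribution_function f (s : R) : \bar R :=
  mu [set x | (s%:E < excabsfun f x)%E].

Definition rearrangement f (t : R) : \bar R :=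
  ereal_inf [set s%:E | s in
    [set s : R | 0 <= s /\ (distribution_function f s <= t%:E)%E]].

Definition equimeasurable f g : Prop :=
  forall t : R, 0 <= t -> rearrangement f t = rearrangement g t.

Definition rearrangement_pairing f g : \bar R :=
  (\int[@lebesgue_measure R]_(t in `[0%R, +oo[)
     (rearrangement f t * rearrangement g t))%E.

Definition abs_pairing f g : \bar R :=
  (\int[mu]_x excabsfun (fun y => excmul (f y) (g y)) x)%E.

Definition resonant : Prop :=
  sigma_finite [set: S] mu /\
  forall f g, excmeasurable f -> excmeasurable g ->
    ereal_sup [set abs_pairing f h | h in
      [set h | excmeasurable h /\ equimeasurable h g]]
    = rearrangement_pairing f g.

Record banach_function_norm (N : (S -> excomplex R) -> \bar R) : Prop := {
  bfn_ge0 : forall f, excmeasurable f -> (0 <= N f)%E ;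
  bfn_abs : forall f, excmeasurable f -> N (excnnfun (excabsfun f)) = N f ;
  bfn_homo : forall (a : R[i]) (u : S -> \bar R), nnmeasurable u ->
    N (excscalefun a (excnnfun u)) = (excabs (excfin a) * N (excnnfun u))%E ;
  bfn_eq0 : forall u : S -> \bar R, nnmeasurable u ->
    (N (excnnfun u) = 0%E <-> {ae mu, forall x, u x = 0%E}) ;
  bfn_triangle : forall u v : S -> \bar R, nnmeasurable u -> nnmeasurable v ->
    (N (excnnfun (fun x => u x + v x)) <= N (excnnfun u) + N (excnnfun v))%E ;
  bfn_lattice : forall u v : S -> \bar R, nnmeasurable u -> nnmeasurable v ->
    {ae mu, forall x, (u x <= v x)%E} -> (N (excnnfun u) <= N (excnnfun v))%E ;
  bfn_fatou : forall (u_ : nat -> S -> \bar R) (u : S -> \bar R),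
    (forall n, nnmeasurable (u_ n)) -> nnmeasurable u ->
    {ae mu, forall x, nondecreasing_seq (fun n => u_ n x) /\
                      u_ n x @[n --> \oo] --> u x} ->
    nondecreasing_seq (fun n => N (excnnfun (u_ n))) /\
    N (excnnfun (u_ n)) @[n --> \oo] --> N (excnnfun u) ;
  bfn_charfun : forall E : set S, measurable E -> (mu E < +oo)%E ->
    (N (excnnfun (charfun E)) < +oo)%E ;
  bfn_local_int : forall E : set S, measurable E -> (mu E < +oo)%E ->
    exists C : R, forall u : S -> \bar R, nnmeasurable u ->
      (\int[mu]_(x in E) u x <= C%:E * N (excnnfun u))%E
}.

Definition rearrangement_invariant (N : (S -> excomplex R) -> \bar R) : Prop :=
  forall f g, excmeasurable f -> excmeasurable g ->
    equimeasurable f g -> N f = N g.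

(** Elements are representatives of
    classes of functions modulo equality a.e. *)
Definition bfspace (N : (S -> excomplex R) -> \bar R) : set (S -> excomplex R) :=
  [set f | excmeasurable f /\ (N f < +oo)%E].

Definition associate_norm (N : (S -> excomplex R) -> \bar R) f : \bar R :=
  ereal_sup [set abs_pairing f g | g in
    [set g | excmeasurable g /\ (N g <= 1)%E]].

Definition ACR (N : (S -> excomplex R) -> \bar R) : Prop :=
  forall f, bfspace N f -> rearrangement f t @[t --> +oo%R] --> 0%E.

Definition ac_subspace (N : (S -> excomplex R) -> \bar R) :
    set (S -> excomplex R) :=
  [set f | bfspace N f /\
    forall E_ : nat -> set S, (forall k, measurable (E_ k)) ->
      {ae mu, forall x, (\1_(E_ k) x : R) @[k --> \oo] --> (0 : R)} ->
      N (excrestr f (E_ k)) @[k --> \oo] --> 0%E].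

(** Neighbourhoods of [f] in the locally convex topology on [bfspace N] given
    by the norms [g |-> rearrangement_pairing w g], for [w] in the associate
    space. *)
Definition xi_nbhs (N : (S -> excomplex R) -> \bar R) f :
    set_system (S -> excomplex R) :=
  [set U | exists (k : nat) (w : 'I_k -> S -> excomplex R) (e : R),
    [/\ 0 < e, forall i, bfspace (associate_norm N) (w i) &
      [set g | bfspace N g /\
         forall i, (rearrangement_pairing (w i) (excsubfun g f) < e%:E)%E]
      `<=` U]].

Definition power_measure_bounded (phi : S -> S) : Prop :=
  measurable_fun [set: S] phi /\
  exists A : R, 0 < A /\
    forall n : nat, (1 <= n)%N -> forall E : set S, measurable E ->
      (mu (iter n phi @^-1` E) <= A%:E * mu E)%E.

Definition composition_operator (phi : S -> S) f : S -> excomplex R := f \o phi.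

Definition cesaro_mean (phi : S -> S) (n : nat) f : S -> excomplex R :=
  excscalefun (n%:R^-1)
    (fun x => \sum_(i < n) iter i (composition_operator phi) f x).

Definition xi_limit_operator (N : (S -> excomplex R) -> \bar R) (phi : S -> S)
    (T : (S -> excomplex R) -> (S -> excomplex R)) : Prop :=
  forall f, bfspace N f ->
    bfspace N (T f) /\ cesaro_mean phi n f @[n --> \oo] `=>` xi_nbhs N (T f).

End banach_function_spaces.

(* Main.v *)
Require Import Defs.
From HB Require Import structures.
From mathcomp Require Import all_boot all_order all_algebra.
From mathcomp Require Import all_classical all_reals all_analysis.
From mathcomp Require Import measurable_realfun.
From mathcomp Require Import ring lra.
From mathcomp.real_closed Require Import complex.

Set Implicit Arguments.
Unset Strict Implicit.
Unset Printing Implicit Defensive.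
Import Order.TTheory GRing.Theory Num.Theory.
Import numFieldNormedType.Exports.
Local Open Scope classical_set_scope.
Local Open Scope ring_scope.

(** Write [nrm N u] for the norm of a measurable [u : S -> [0, +oo]] and [rear]
    for the decreasing rearrangement; every statement about complex functions is
    reduced to their moduli.  The argument has four ingredients.

    Duality.  The norm [N] is recovered from the unit ball of the associate
    space (the theorem of Lorentz and Luxemburg, [nrm_le_dual]).  It suffices to
    separate a bounded [u], with support of finite measure and norm above [c],
    from the ball of radius [c].  The [L2] projection of [u] on the part of this
    ball between [0] and [u] exists by the parallelogram identity and Fatou's
    property (P3), and its residual is the separating functional.

    Resonance.  Since the supremum of the integrals of [u] against all functions
    equimeasurable with [w] is the integral of [rear u * rear w], duality becomes
    a formula for [N] through rearrangements ([rpair_le_nrm], [nrm_le_rpair]).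
    Hence an inequality between distribution functions
    [distr u <= C * distr v] with [1 <= C] gives [nrm u <= C * nrm v]
    ([nrm_distr]), by the change of variable [t / C].  For a power-measure-bounded
    [phi] this bounds all Cesaro means by [C] on the whole space ([nrm_cesaro]),
    so that only bounded [g] with support of finite measure have to be
    considered, these being dense in the functions with absolutely continuous
    norm ([ac_truncation]).

    Smallness.  Let [H] be the modulus of the difference of two Cesaro means of
    such a [g].  It is bounded in [L1] and in [L-infinity], and convergence in
    the topology [xi], tested on one characteristic function, makes it tend to
    [0] in measure.  Where [H] is large, its norm is controlled by the norm of
    the characteristic function of a set of small measure, which tends to [0] as
    soon as some nonzero function has absolutely continuous norm
    ([ac_small_sets]).  Where [H] is at most [eps], its norm is small because of
    the (ACR) property of the associate space, which excludes constants from it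
    when the measure is infinite ([nrm_small_functions]).  So the Cesaro means
    form a Cauchy sequence for the norm ([cesaro_cauchy]).

    Limit.  By [nrm_le_rpair] the norm is a supremum of seminorms continuous for
    [xi], hence lower semicontinuous, and the Cauchy property passes to the
    limit: the distance from the n-th mean to [T f] tends to [0]
    ([cesaro_cvg_norm]).  Absolute continuity of the norm of [T f] follows by
    approximation by means of bounded functions. *)

(** * Moduli of extended complex numbers *)
Section excomplex_arithmetic.
Context {R : rcfType}.
Implicit Types (x y z : excomplex R).
Local Open Scope ereal_scope.

Lemma excabs_ge0 x : 0 <= excabs x.
Proof.
case: x => [[a b]|] /=; last exact: leey.
by rewrite lee_fin sqrtr_ge0.
Qed.

Lemma le_excabsD x y : excabs (x + y)%R <= excabs x + excabs y.
Proof.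
case: x => [a|]; case: y => [b|] //=; rewrite ?addye ?addey ?leey //.
rewrite -EFinD lee_fin.
by have := ler_normD a b; rewrite lecE raddfD => /andP[].
Qed.

Lemma excabsM x y : excabs (excmul x y) = excabs x * excabs y.
Proof.
have key (a : R[i]) : a != 0%R -> (0 < complex.Re `|a|)%R.
  by rewrite -normr_gt0 ltcE => /andP[_].
case: x => [a|]; case: y => [b|]; rewrite /excmul /excabs.
- by rewrite -EFinM normrM; congr EFin; rewrite /= !mulr0 subr0.
- case: eqVneq => [->|a0]; first by rewrite normr0 mul0e.
  by rewrite gt0_muley // lte_fin key.
- case: eqVneq => [->|a0]; first by rewrite normr0 mule0.
  by rewrite gt0_mulye // lte_fin key.
- by rewrite mulyy.
Qed.

Lemma excabs_real (a : R) : excabs (excfin a%:C%C) = `|a|%:E.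
Proof. by rewrite /= expr0n addr0 sqrtr_sqr. Qed.

Lemma excabs_nat (n : nat) : excabs (excfin ((n%:R)^-1)%R : excomplex R) = ((n%:R)^-1)%:E.
Proof.
have -> : ((n%:R)^-1 : R[i])%R = ((n%:R)^-1)%:C%C.
  by rewrite fmorphV rmorph_nat.
by rewrite excabs_real ger0_norm // invr_ge0.
Qed.

Lemma excabs_exc_of_ereal (r : \bar R) : 0 <= r -> excabs (exc_of_ereal r) = r.
Proof.
by case: r => [r|//|//]; rewrite lee_fin => r0; rewrite excabs_real ger0_norm.
Qed.

(** The scalar has to be finite: infinity times [1 - 1] is [0], whereas infinity
    times [1] plus infinity times [-1] is infinity. *)
Lemma excmulDr (a : R[i]) y z :
  excmul (excfin a) (y + z)%R = (excmul (excfin a) y + excmul (excfin a) z)%R.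
Proof.
case: y z => [b|] [c|]; rewrite /GRing.add /= ?mulrDr //;
  by case: (eqVneq a 0%R) => [a0|_] //=; rewrite ?a0 ?mul0r ?add0r.
Qed.

Lemma excabsN x : excabs (excmul (excfin (-1)%R) x) = excabs x.
Proof. by rewrite excabsM /excabs /excfin normrN1 mul1e. Qed.

Lemma le_excabsB x y : excabs (excsub x y) <= excabs x + excabs y.
Proof. by rewrite -(excabsN y); exact: le_excabsD. Qed.

Lemma excsub_infty x : excsub x excinfty = excinfty :> excomplex R.
Proof. by rewrite /excsub /= oppr_eq0 oner_eq0; case: x. Qed.

Lemma excabs_subC x y :
  excabs (excsub x y) = excabs (excsub y x).
Proof.
case: x => [a|]; last by rewrite excsub_infty.
case: y => [b|]; last by rewrite excsub_infty.
rewrite -excabsN /excsub /GRing.add /=.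
by rewrite (_ : (-1 * (a + -1 * b) = b + -1 * a)%R) //; ring.
Qed.

Lemma adde_excabs_infty x : excabs x + +oo = +oo.
Proof. by rewrite addey // gt_eqF // (lt_le_trans _ (excabs_ge0 _)). Qed.

Lemma excabs_sub_trans x y z :
  excabs (excsub x z) <= excabs (excsub x y) + excabs (excsub y z).
Proof.
case: y => [b|]; last by rewrite adde_excabs_infty leey.
case: z => [c|]; last by rewrite !excsub_infty adde_excabs_infty.
case: x => [a|]; last by rewrite addeC adde_excabs_infty.
apply: le_trans (le_excabsD _ _).
by rewrite /excsub /GRing.add /= (_ : (_ + (b + -1 * c) = a + -1 * c)%R) //; ring.
Qed.

Lemma excabs_le_sub x y : excabs y <= excabs (excsub x y) + excabs x.
Proof.
case: x => [a|]; last by rewrite adde_excabs_infty leey.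
case: y => [b|]; last by rewrite excsub_infty addeC adde_excabs_infty.
rewrite -(excabsN (excsub _ _)); apply: le_trans (le_excabsD _ _).
by rewrite /excsub /GRing.add /= (_ : (_ + a = b)%R) //; ring.
Qed.

(** Comparison of two sums termwise: it separates, in a difference of Cesaro
    means, the truncated part of a function from its remainder. *)
Lemma excabs_subDD x y x' y' : excabs (excsub (x + y)%R (x' + y')%R) <=
  excabs (excsub x x') + (excabs y + excabs y').
Proof.
have -> : excsub (x + y)%R (x' + y')%R = (excsub x x' + excsub y y')%R.
  by rewrite /excsub excmulDr addrACA.
by rewrite (le_trans (le_excabsD _ _)) // leeD2l // le_excabsB.
Qed.

End excomplex_arithmetic.

(** * Measurability of extended complex and nonnegative functions *)
Section measurability.
Context {R : realType} {d : measure_display} {S : measurableType d}.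
Implicit Types (f g : S -> excomplex R) (u v : S -> \bar R).

Local Definition is_excinfty (x : excomplex R) : bool := if x is Some _ then false else true.

Lemma excmeasurableP f : excmeasurable f <->
  [/\ measurable_fun [set: S] (is_excinfty \o f), measurable_fun [set: S] (excRe \o f) &
      measurable_fun [set: S] (excIm \o f)].
Proof.
have E : [set x | f x = excinfty] = (is_excinfty \o f) @^-1` [set true].
  by apply/seteqP; split => x /=; case: (f x).
split=> -[mi mr mm]; split => //.
  by apply: (measurable_fun_bool true); rewrite setTI -E.
by rewrite E -[X in measurable X]setTI; exact: mi.
Qed.

Lemma excmeasurable_if (b : S -> bool) f g : measurable_fun [set: S] b ->
  excmeasurable f -> excmeasurable g ->
  excmeasurable (fun x => if b x then f x else g x).
Proof.
move=> mb /excmeasurableP[f1 f2 f3] /excmeasurableP[g1 g2 g3].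
have E (T : Type) (h : excomplex R -> T) :
    h \o (fun x => if b x then f x else g x) =
    (fun x => if b x then (h \o f) x else (h \o g) x).
  by apply/funext => x /=; case: ifP.
by apply/excmeasurableP; split; rewrite E; exact: measurable_fun_ifT.
Qed.

Lemma excmeasurable_cst (z : excomplex R) : excmeasurable (fun _ : S => z).
Proof. by apply/excmeasurableP; split; exact: measurable_cst. Qed.

Lemma excmeasurable_fin (a b : S -> R) : measurable_fun [set: S] a ->
  measurable_fun [set: S] b -> excmeasurable (fun x => excfin (a x +i* b x)%C).
Proof. by move=> ma mb; apply/excmeasurableP; split => //; exact: measurable_cst. Qed.

Lemma excmeasurableD f g : excmeasurable f -> excmeasurable g ->
  excmeasurable (fun x => (f x + g x)%R).
Proof.
move=> /excmeasurableP[f1 f2 f3] /excmeasurableP[g1 g2 g3].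
rewrite (_ : (fun _ => _) = fun x => if is_excinfty (f x) || is_excinfty (g x) then excinfty else
  excfin ((excRe (f x) + excRe (g x)) +i* (excIm (f x) + excIm (g x)))%C).
  apply: excmeasurable_if; first exact: measurable_or.
    exact: excmeasurable_cst.
  by apply: excmeasurable_fin; exact: measurable_funD.
by apply/funext => x; case: (f x) (g x) => [[? ?]|] [[? ?]|].
Qed.

Lemma excmeasurableZ (a : R[i]) f : excmeasurable f -> excmeasurable (excscalefun a f).
Proof.
move=> /excmeasurableP[f1 f2 f3].
have [->|a0] := eqVneq a 0.
  rewrite (_ : excscalefun 0 f = fun=> excfin 0); first exact: excmeasurable_cst.
  apply/funext => x; rewrite /excscalefun /excmul /=.
  by case: (f x) => [b|]; rewrite ?mul0r // eqxx.
rewrite (_ : excscalefun a f = fun x => if is_excinfty (f x) then excinfty else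
  excfin ((complex.Re a * excRe (f x) - complex.Im a * excIm (f x)) +i*
   (complex.Re a * excIm (f x) + complex.Im a * excRe (f x)))%C).
  apply: excmeasurable_if => //; first exact: excmeasurable_cst.
  apply: excmeasurable_fin; first apply: measurable_funB; last apply: measurable_funD;
    apply: measurable_funM => //; exact: measurable_cst.
apply/funext => x; rewrite /excscalefun; case: (f x) => [[b c]|] /=; last by rewrite (negbTE a0).
by case: a {a0} => ? ?.
Qed.

Lemma excmeasurable_comp (phi : S -> S) f : measurable_fun [set: S] phi ->
  excmeasurable f -> excmeasurable (f \o phi).
Proof.
move=> mphi /excmeasurableP[f1 f2 f3]; apply/excmeasurableP.
by split; rewrite compA; exact: measurableT_comp.
Qed.

Lemma excmeasurable_sum (I : Type) (s : seq I) (F : I -> S -> excomplex R) :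
  (forall i, excmeasurable (F i)) -> excmeasurable (fun x => \sum_(i <- s) F i x).
Proof.
move=> mF; elim: s => [|i s IH].
  rewrite (_ : (fun _ => _) = fun=> 0); first exact: excmeasurable_cst.
  by apply/funext => x; rewrite big_nil.
rewrite (_ : (fun _ => _) = fun x => F i x + \sum_(j <- s) F j x); first exact: excmeasurableD.
by apply/funext => x; rewrite big_cons.
Qed.

Lemma excmeasurableB f g : excmeasurable f -> excmeasurable g ->
  excmeasurable (excsubfun f g).
Proof. by move=> mf mg; apply: excmeasurableD => //; exact: excmeasurableZ. Qed.

Lemma excrestrE f (E : set S) x : excrestr f E x = if x \in E then f x else excfin 0.
Proof.
rewrite /excrestr /excnnfun /charfun /= indicE; case: ifP => _ /=; case: (f x) => [a|] //=.
- by rewrite mulr1.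
- by rewrite (_ : (1%:C%C == 0 :> R[i]) = false) // oner_eq0.
- by rewrite mulr0.
- by rewrite eqxx.
Qed.

Lemma measurable_fun_mem (E : set S) : measurable E -> measurable_fun [set: S] (mem E : S -> bool).
Proof.
move=> mE; apply: (measurable_fun_bool true); rewrite setTI.
by rewrite (_ : _ @^-1` _ = E) //; apply/seteqP; split => x /=; [exact: set_mem|exact: mem_set].
Qed.

Lemma excmeasurable_restr f (E : set S) : measurable E -> excmeasurable f ->
  excmeasurable (excrestr f E).
Proof.
move=> mE mf; rewrite (_ : excrestr f E = fun x => if x \in E then f x else excfin 0).
  by apply: excmeasurable_if => //; [exact: measurable_fun_mem|exact: excmeasurable_cst].
by apply/funext => x; rewrite excrestrE.
Qed.

Lemma nn_excabs f : excmeasurable f -> nnmeasurable (excabsfun f).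
Proof.
move=> /excmeasurableP[f1 f2 f3]; split; last by move=> x; exact: excabs_ge0.
rewrite (_ : excabsfun f = fun x => if is_excinfty (f x) then +oo%E else
   (Num.sqrt (excRe (f x) ^+ 2 + excIm (f x) ^+ 2))%:E).
  apply: measurable_fun_ifT => //.
  apply/measurable_EFinP/(@measurableT_comp _ _ _ _ _ _ (@Num.sqrt R)).
    by apply: continuous_measurable_fun; exact: sqrt_continuous.
  by apply: measurable_funD; exact: measurable_funX.
by apply/funext => x; rewrite /excabsfun /=; case: (f x) => [[? ?]|].
Qed.

Lemma excmeasurable_nn u : nnmeasurable u -> excmeasurable (excnnfun u).
Proof.
move=> [mu u0].
rewrite (_ : excnnfun u = fun x => if (u x == +oo)%E then excinfty else
  excfin (fine (u x) +i* 0)%C).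
  apply: excmeasurable_if; first exact: measurable_fun_eqe.
    exact: excmeasurable_cst.
  by apply: excmeasurable_fin => //; exact: measurableT_comp.
by apply/funext => x; rewrite /excnnfun /=; have := u0 x; case: (u x).
Qed.

Lemma excabsfun_nn u : (forall x, 0 <= u x)%E -> excabsfun (excnnfun u) = u.
Proof. by move=> u0; apply/funext => x; exact: excabs_exc_of_ereal. Qed.

Lemma nnD u v : nnmeasurable u -> nnmeasurable v -> nnmeasurable (fun x => u x + v x)%E.
Proof.
by move=> [? ?] [? ?]; split=> [|x]; [exact: emeasurable_funD|rewrite adde_ge0].
Qed.

Lemma nnM u v : nnmeasurable u -> nnmeasurable v -> nnmeasurable (fun x => u x * v x)%E.
Proof.
by move=> [? ?] [? ?]; split=> [|x]; [exact: emeasurable_funM|rewrite mule_ge0].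
Qed.

Lemma nn_cst (c : \bar R) : (0 <= c)%E -> nnmeasurable (fun _ : S => c).
Proof. by move=> c0; split=> //; exact: measurable_cst. Qed.

Lemma nnZ (c : R) u : 0 <= c -> nnmeasurable u -> nnmeasurable (fun x => c%:E * u x)%E.
Proof. by move=> c0 nu; apply: nnM => //; exact: nn_cst. Qed.

Lemma nn_comp (phi : S -> S) u : measurable_fun [set: S] phi -> nnmeasurable u ->
  nnmeasurable (u \o phi).
Proof. by move=> mphi [mu u0]; split=> [|x]; [exact: measurableT_comp|exact: u0]. Qed.

Lemma nn_min u v : nnmeasurable u -> nnmeasurable v -> nnmeasurable (fun x => mine (u x) (v x)).
Proof.
by move=> [? u0] [? v0]; split=> [|x]; [exact: measurable_mine|rewrite le_min u0 v0].
Qed.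

Lemma nn_charfun (E : set S) : measurable E -> nnmeasurable (charfun E : S -> \bar R).
Proof.
move=> mE; split=> [|x]; first exact/measurable_EFinP/measurable_indic.
by rewrite lee_fin.
Qed.

Lemma nn_sum (I : Type) (s : seq I) (F : I -> S -> \bar R) :
  (forall i, nnmeasurable (F i)) -> nnmeasurable (fun x => \sum_(i <- s) F i x)%E.
Proof.
move=> mF; split=> [|x]; first by apply: emeasurable_sum => i; exact: (mF i).1.
by apply: sume_ge0 => i _; exact: (mF i).2.
Qed.

Lemma nn_EFin (g : S -> R) : measurable_fun [set: S] g -> (forall x, 0 <= g x) ->
  nnmeasurable (EFin \o g).
Proof. by move=> mg g0; split=> [|x]; [exact/measurable_EFinP|rewrite /= lee_fin]. Qed.

End measurability.

(** * Integrals of bounded functions supported by a set of finite measure *)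
Section bounded_integrals.
Context {R : realType} {d : measure_display} {S : measurableType d}.
Variables (mu : {measure set S -> \bar R}) (E : set S).
Hypotheses (mE : measurable E) (muE : (mu E < +oo)%E).
Implicit Types g h : S -> R.

(** Bounded with support in [E].  As [E] has finite measure, these functions
    form an algebra on which the real-valued integral is linear. *)
Definition bounded_on g : Prop :=
  measurable_fun [set: S] g /\ exists B : R, forall x, `|g x| <= B * \1_E x.

Lemma integrable_bounded_on g : bounded_on g -> mu.-integrable [set: S] (EFin \o g).
Proof.
move=> [mg [B gB]]; apply: (@le_integrable _ _ _ _ _ _ _ (fun x => (B * \1_E x)%:E)) => //.
- exact/measurable_EFinP.
- by move=> x _; rewrite lee_fin (le_trans (gB x)) // ler_norm.
have muE' : (mu E \is a fin_num) by rewrite ge0_fin_numE.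
apply/integrableP; split.
  apply/measurable_EFinP; apply: measurable_funM => //; exact: measurable_cst.
under eq_integral do rewrite EFinM abseM [`|(\1_E _)%:E|%E]gee0_abs ?lee_fin //.
have m1 : measurable_fun [set: S] (fun x => (\1_E x : R)%:E).
  exact/measurable_EFinP/measurable_indic.
rewrite ge0_integralZl //.
by rewrite integral_indic // setIT lte_mul_pinfty // ?abse_ge0 //.
Qed.

Lemma bounded_onD g h : bounded_on g -> bounded_on h -> bounded_on (fun x => g x + h x).
Proof.
move=> [mg [B gB]] [mh [C hC]]; split; first exact: measurable_funD.
by exists (B + C) => x; rewrite (le_trans (ler_normD _ _)) // mulrDl lerD.
Qed.

Lemma bounded_onM g h : bounded_on g -> bounded_on h -> bounded_on (fun x => g x * h x).
Proof.
move=> [mg [B gB]] [mh [C hC]]; split; first exact: measurable_funM.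
exists (B * C) => x; rewrite normrM.
have -> : B * C * \1_E x = (B * \1_E x) * (C * \1_E x).
  by rewrite indicE; case: (_ \in _); rewrite /= ?mulr0 ?mulr1.
by apply: ler_pM.
Qed.

Lemma bounded_onZ (a : R) g : bounded_on g -> bounded_on (fun x => a * g x).
Proof.
move=> [mg [B gB]]; split; first by apply: measurable_funM => //; exact: measurable_cst.
by exists (`|a| * B) => x; rewrite normrM -mulrA ler_wpM2l.
Qed.

Lemma bounded_onB g h : bounded_on g -> bounded_on h -> bounded_on (fun x => g x - h x).
Proof.
move=> bg /(bounded_onZ (-1)) bh; have := bounded_onD bg bh.
by under eq_fun do rewrite mulN1r.
Qed.

Lemma bounded_on_indic : bounded_on (\1_E : S -> R).
Proof.
by split; [exact: measurable_indic|exists 1 => x; rewrite mul1r ger0_norm].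
Qed.

Lemma bounded_on_le g h : measurable_fun [set: S] g -> (forall x, `|g x| <= `|h x|) ->
  bounded_on h -> bounded_on g.
Proof. by move=> mg gh [mh [B hB]]; split=> //; exists B => x; rewrite (le_trans (gh x)). Qed.

Local Notation I g := (\int[mu]_x g x)%R.

Lemma IntD g h : bounded_on g -> bounded_on h -> I (fun x => g x + h x) = I g + I h.
Proof. by move=> bg bh; rewrite RintegralD //; exact: integrable_bounded_on. Qed.

Lemma IntB g h : bounded_on g -> bounded_on h -> I (fun x => g x - h x) = I g - I h.
Proof. by move=> bg bh; rewrite RintegralB //; exact: integrable_bounded_on. Qed.

Lemma IntZ (a : R) g : bounded_on g -> I (fun x => a * g x) = a * I g.
Proof. by move=> bg; rewrite RintegralZl //; exact: integrable_bounded_on. Qed.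

Lemma Int_le g h : bounded_on g -> bounded_on h -> (forall x, g x <= h x) -> I g <= I h.
Proof. by move=> bg bh gh; apply: le_Rintegral => //; exact: integrable_bounded_on. Qed.

Lemma Int_EFin g : bounded_on g -> (\int[mu]_x (g x)%:E = (I g)%:E)%E.
Proof.
by move=> bg; rewrite /Rintegral fineK //; exact/integrable_fin_num/integrable_bounded_on.
Qed.

End bounded_integrals.

(** * Truncations *)
Section truncation.
Context {R : realType} {d : measure_display} {S : measurableType d}.
Implicit Types (u : S -> \bar R) (A : nat -> set S).
Local Open Scope ereal_scope.

(** An increasing approximation of [u] by bounded functions carried by the
    sets [A k]; the form in which the Fatou property is applied. *)
Definition trunc u A (k : nat) (x : S) : \bar R := mine (u x) k%:R%:E * charfun (A k) x.

Lemma nn_trunc u A k : nnmeasurable u -> measurable (A k) -> nnmeasurable (trunc u A k).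
Proof.
move=> nu mA; apply: nnM; last exact: nn_charfun.
by apply: nn_min => //; exact: nn_cst.
Qed.

Lemma trunc_ge0 u A k x : (forall x, 0 <= u x) -> 0 <= trunc u A k x.
Proof. by move=> u0; apply: mule_ge0; [rewrite le_min u0 lee_fin /=|rewrite /charfun lee_fin]. Qed.

Lemma trunc_le u A k x : (forall x, 0 <= u x) -> trunc u A k x <= u x.
Proof.
move=> u0; rewrite /trunc /charfun indicE; case: (_ \in _); last by rewrite mule0.
by rewrite mule1 ge_min lexx.
Qed.

Lemma trunc_bound u A k x : trunc u A k x <= (k%:R * \1_(A k) x)%:E.
Proof. by rewrite EFinM; apply: lee_wpmul2r; rewrite ?lee_fin // ge_min lexx orbT. Qed.

Lemma trunc_fin_num u A k x : (forall x, 0 <= u x) -> trunc u A k x \is a fin_num.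
Proof.
move=> u0; rewrite ge0_fin_numE ?trunc_ge0 //.
by rewrite (le_lt_trans (trunc_bound _ _ _ _)) // ltry.
Qed.

Lemma trunc_nd u A x : (forall x, 0 <= u x) -> nondecreasing_seq A ->
  nondecreasing_seq (fun k => trunc u A k x).
Proof.
move=> u0 ndA i j ij; apply: lee_pmul; rewrite /charfun ?lee_fin //.
- by rewrite le_min u0 lee_fin /=.
- by rewrite le_min ge_min lexx /= ge_min lee_fin ler_nat ij orbT.
- rewrite !indicE; case: (boolP (x \in A i)) => [xA|_] //.
  rewrite (mem_set (_ : A j x)) //.
  by have /subsetPset := ndA _ _ ij; apply; exact: set_mem.
Qed.

Lemma trunc_cvg u A x : (forall x, 0 <= u x) -> nondecreasing_seq A ->
  (exists k, A k x) -> trunc u A k x @[k --> \oo] --> u x.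
Proof.
move=> u0 ndA [k0 Akx].
have E : \forall k \near \oo, trunc u A k x = mine (u x) k%:R%:E.
  near=> k; rewrite /trunc /charfun indicE mem_set ?mule1 //.
  have /subsetPset : (A k0 <= A k)%O by apply: ndA; near: k; exact: nbhs_infty_ge.
  by apply.
have [u_oo|u_fin] := eqVneq (u x) +oo.
  rewrite u_oo; apply: (@cvg_trans _ (k%:R%:E @[k --> \oo] : set_system (\bar R))).
    apply: near_eq_cvg; near=> k; rewrite (near E k) // u_oo /mine ltNge leey //.
  by apply/cvgeryP; exact: cvgr_idn.
apply: cvg_near_cst; near=> k; rewrite (near E k) // min_l //.
have ufin : u x \is a fin_num by rewrite ge0_fin_numE // lt_neqAle u_fin leey.
rewrite -(fineK ufin) lee_fin; near: k; exact: nbhs_infty_ger.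
Unshelve. all: by end_near. Qed.

End truncation.

(** * Function norms and the pairing *)
Section function_norm.
Context {R : realType} {d : measure_display} {S : measurableType d}.
Variables (mu : {measure set S -> \bar R}) (N : (S -> excomplex R) -> \bar R).
Hypothesis HN : banach_function_norm mu N.
Implicit Types u v w : S -> \bar R.
Local Open Scope ereal_scope.

Definition nrm u : \bar R := N (excnnfun u).

Definition pairing u v : \bar R := \int[mu]_x (u x * v x).

(** The nonnegative part of the unit ball of the associate space. *)
Definition dual_ball w : Prop :=
  nnmeasurable w /\ forall v, nnmeasurable v -> nrm v <= 1 -> pairing v w <= 1.

Lemma nrmE f : excmeasurable f -> N f = nrm (excabsfun f).
Proof. by move=> mf; rewrite /nrm (bfn_abs HN). Qed.

Lemma nrm_ge0 u : nnmeasurable u -> 0 <= nrm u.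
Proof. by move=> nu; apply: (bfn_ge0 HN); exact: excmeasurable_nn. Qed.

Lemma nrmZ (c : R) u : (0 <= c)%R -> nnmeasurable u ->
  nrm (fun x => c%:E * u x) = c%:E * nrm u.
Proof.
move=> c0 nu; have := bfn_homo HN c%:C%C nu.
rewrite excabs_real ger0_norm // => <-; congr N; apply/funext => x.
rewrite /excnnfun /excscalefun /=; have := nu.2 x.
case: (u x) => [r| |] //= _; first by rewrite rmorphM.
have [->|c1] := eqVneq c 0%R; first by rewrite mul0e /= eqxx.
rewrite gt0_muley ?lte_fin ?lt0r ?c1 //=.
by rewrite ifF //; apply/negbTE; rewrite eq_complex /= eqxx andbT.
Qed.

Lemma nrm_le_ae u v : nnmeasurable u -> nnmeasurable v ->
  {ae mu, forall x, u x <= v x} -> nrm u <= nrm v.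
Proof. by move=> nu nv uv; exact: (bfn_lattice HN). Qed.

Lemma nrm_le u v : nnmeasurable u -> nnmeasurable v ->
  (forall x, u x <= v x) -> nrm u <= nrm v.
Proof. by move=> nu nv uv; apply: nrm_le_ae => //; exact: aeW. Qed.

Lemma nrmD u v : nnmeasurable u -> nnmeasurable v ->
  nrm (fun x => u x + v x) <= nrm u + nrm v.
Proof. by move=> nu nv; exact: (bfn_triangle HN). Qed.

Lemma nrm_sum (I : Type) (s : seq I) (F : I -> S -> \bar R) :
  (forall i, nnmeasurable (F i)) ->
  nrm (fun x => \sum_(i <- s) F i x) <= \sum_(i <- s) nrm (F i).
Proof.
move=> mF; elim: s => [|i s IH].
  rewrite big_nil (_ : (fun _ => _) = fun x => 0%:E * 0).
    by rewrite nrmZ ?mul0e //; exact: nn_cst.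
  by apply/funext => x; rewrite big_nil mul0e.
rewrite big_cons (_ : (fun _ => _) = fun x => F i x + \sum_(j <- s) F j x).
  by apply: le_trans (nrmD _ _) _ => //; [exact: nn_sum|rewrite leeD2l].
by apply/funext => x; rewrite big_cons.
Qed.

Lemma nrm_le_lim (c : \bar R) (u_ : nat -> S -> \bar R) u :
  (forall n, nnmeasurable (u_ n)) -> nnmeasurable u ->
  (forall x, nondecreasing_seq (u_ ^~ x)) -> (forall x, u_ ^~ x @ \oo --> u x) ->
  (forall n, nrm (u_ n) <= c) -> nrm u <= c.
Proof.
move=> nu_ nu nd cv le_c.
have [_ cvn] : nondecreasing_seq (fun n => N (excnnfun (u_ n))) /\
    N (excnnfun (u_ n)) @[n --> \oo] --> N (excnnfun u).
  by apply: (bfn_fatou HN) => //; apply: aeW => x; split.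
rewrite /nrm -(cvg_lim _ cvn) //; apply: lime_le; first exact: cvgP cvn.
exact: nearW.
Qed.

Lemma pairingC u v : pairing u v = pairing v u.
Proof. by apply: eq_integral => x _; rewrite muleC. Qed.

Lemma pairingZ (c : R) u v : (0 <= c)%R -> nnmeasurable u -> nnmeasurable v ->
  pairing (fun x => c%:E * u x) v = c%:E * pairing u v.
Proof.
move=> c0 nu nv; have [muv uv0] := nnM nu nv.
rewrite /pairing; under eq_integral do rewrite -muleA.
by rewrite ge0_integralZl.
Qed.

Lemma pairing_le u u' v : nnmeasurable u -> nnmeasurable u' -> nnmeasurable v ->
  (forall x, u x <= u' x) -> pairing u v <= pairing u' v.
Proof.
move=> nu nu' nv uu'; have [muv uv0] := nnM nu nv; have [muv' _] := nnM nu' nv.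
by apply: ge0_le_integral => // x _; rewrite lee_wpmul2r // nv.2.
Qed.

Lemma pairingD u u' v : nnmeasurable u -> nnmeasurable u' -> nnmeasurable v ->
  pairing (fun x => u x + u' x) v = pairing u v + pairing u' v.
Proof.
move=> nu nu' nv; have [muv uv0] := nnM nu nv; have [muv' uv0'] := nnM nu' nv.
rewrite -ge0_integralD //; apply: eq_integral => x _.
by rewrite ge0_muleDl ?nu.2 ?nu'.2.
Qed.

(** Monotone convergence for the pairing.  Convergence of [u_] is required only
    off the zeros of [w], which allows approximations of [u] supported by a set
    carrying [w]; the products converge at a point where [w] is infinite because
    either the limit is nonzero or all terms vanish. *)
Lemma pairing_le_lim (c : \bar R) (u_ : nat -> S -> \bar R) u w :
  (forall n, nnmeasurable (u_ n)) -> nnmeasurable u -> nnmeasurable w ->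
  (forall x, nondecreasing_seq (u_ ^~ x)) ->
  (forall x, w x != 0 -> u_ ^~ x @ \oo --> u x) ->
  (forall n, pairing (u_ n) w <= c) -> pairing u w <= c.
Proof.
move=> nu_ nu nw nd cv le_c.
have cvx x : (u_ n x * w x) @[n --> \oo] --> u x * w x.
  have [->|w0] := eqVneq (w x) 0.
    by rewrite mule0; under eq_fun do rewrite mule0; exact: cvg_cst.
  have cvu := cv x w0.
  have [u0|u0] := eqVneq (u x) 0.
    have un0 n : u_ n x = 0.
      apply/eqP; rewrite eq_le (nu_ n).2 andbT -u0.
      have <- := cvg_lim _ cvu => //.
      have /cvg_lim -> // := ereal_nondecreasing_cvgn (nd x).
      by apply: ereal_sup_ubound; exists n.
    by rewrite u0 mul0e; under eq_fun do rewrite un0 mul0e; exact: cvg_cst.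
  apply: cvgeM => //; last exact: cvg_cst.
  by rewrite neq0_mule_def // mule_neq0.
have -> : pairing u w = \int[mu]_x (fun x => limn (fun n => u_ n x * w x)) x.
  by apply: eq_integral => x _; apply/esym/cvg_lim => //; exact: cvx.
have cvi : \int[mu]_x (u_ n x * w x) @[n --> \oo] -->
    \int[mu]_x (fun x => limn (fun n => u_ n x * w x)) x.
  apply: cvg_monotone_convergence => //.
  - by move=> n; exact: (nnM (nu_ n) nw).1.
  - by move=> n x _; exact: (nnM (nu_ n) nw).2.
  - by move=> x _ i j ij; rewrite lee_wpmul2r ?nw.2 // nd.
rewrite -(cvg_lim _ cvi) //; apply: lime_le; first exact: cvgP cvi.
exact: nearW.
Qed.

End function_norm.

(** * Projection on an order interval of the ball *)
Section projection.
Context {R : realType} {d : measure_display} {S : measurableType d}.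
Variables (mu : {measure set S -> \bar R}) (N : (S -> excomplex R) -> \bar R).
Hypothesis HN : banach_function_norm mu N.
Variables (E : set S) (u : S -> R) (M c : R).
Hypotheses (mE : measurable E) (muE : (mu E < +oo)%E).
Hypotheses (meas_u : measurable_fun [set: S] u) (u0 : forall x, 0 <= u x).
Hypotheses (M0 : 0 <= M) (uM : forall x, u x <= M * \1_E x).
Hypothesis c0 : 0 < c.

Local Notation I g := (\int[mu]_x g x)%R.
Local Notation bounded_on := (@bounded_on R d S E).

Definition sqdist (g : S -> R) : R := I (fun x => (u x - g x) ^+ 2).

(** Restricting the ball of radius [c] to the order interval between [0] and [u]
    bounds everything in sight, and costs nothing: replacing [g] by the minimum
    of [g] and [u] brings it closer to [u]. *)
Definition lower_ball (g : S -> R) : Prop :=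
  [/\ measurable_fun [set: S] g, forall x, 0 <= g x, forall x, g x <= u x &
      (nrm N (EFin \o g) <= c%:E)%E].

Lemma bounded_on_u : bounded_on u.
Proof. by split=> //; exists M => x; rewrite ger0_norm. Qed.

Lemma lower_ball_bounded g : lower_ball g -> bounded_on g.
Proof.
move=> [mg g0 gu _]; apply: bounded_on_le bounded_on_u => // x.
by rewrite !ger0_norm.
Qed.

Lemma bounded_on_sq g : bounded_on g -> bounded_on (fun x => g x ^+ 2).
Proof. by move=> bg; under eq_fun do rewrite expr2; exact: bounded_onM. Qed.

Lemma bounded_on_sqdist g : bounded_on g -> bounded_on (fun x => (u x - g x) ^+ 2).
Proof. by move=> bg; apply/bounded_on_sq/bounded_onB => //; exact: bounded_on_u. Qed.

Lemma nrm_convex (t : R) g h : 0 <= t <= 1 ->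
  nnmeasurable (EFin \o g) -> nnmeasurable (EFin \o h) ->
  (nrm N (EFin \o g) <= c%:E)%E -> (nrm N (EFin \o h) <= c%:E)%E ->
  (nrm N (EFin \o (fun x => (1 - t) * g x + t * h x)%R) <= c%:E)%E.
Proof.
move=> /andP[t0 t1] ng nh gc hc.
have t1' : 0 <= 1 - t by rewrite subr_ge0.
rewrite (_ : _ \o _ = fun x => ((1 - t)%R%:E * (g x)%:E + t%:E * (h x)%:E)%E) //.
apply: (le_trans (nrmD HN _ _)); try by apply: nnZ.
rewrite !(nrmZ HN) //.
have -> : c%:E = ((1 - t)%R%:E * c%:E + t%:E * c%:E)%E.
  by rewrite -!EFinM -EFinD; congr EFin; ring.
by apply: leeD; rewrite lee_wpmul2l ?lee_fin.
Qed.

Lemma lower_ball0 : lower_ball (fun=> 0).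
Proof.
split=> //.
rewrite (_ : _ \o _ = fun x => (0%:E * 0)%E); last by apply/funext => x; rewrite mul0e.
rewrite (nrmZ HN) ?mul0e //.
by rewrite lee_fin ltW.
Qed.

Lemma lower_ball_mid g h : lower_ball g -> lower_ball h ->
  lower_ball (fun x => (g x + h x) / 2).
Proof.
move=> [mg g0 gu gc] [mh h0 hu hc]; split.
- by apply: measurable_funM; [exact: measurable_funD|exact: measurable_cst].
- by move=> x; have := g0 x; have := h0 x; lra.
- by move=> x; have := gu x; have := hu x; lra.
rewrite (_ : (fun x => (g x + h x) / 2) = fun x => (1 - 2^-1) * g x + 2^-1 * h x).
  by apply: nrm_convex => //; [lra|exact: nn_EFin|exact: nn_EFin].
by apply/funext => x; field.
Qed.

Lemma sqdist_parallelogram g h : bounded_on g -> bounded_on h ->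
  I (fun x => (g x - h x) ^+ 2) =
  2 * (sqdist g + sqdist h - 2 * sqdist (fun x => (g x + h x) / 2)).
Proof.
move=> bg bh.
have bm : bounded_on (fun x => (g x + h x) / 2).
  under eq_fun do rewrite mulrC.
  exact/bounded_onZ/bounded_onD.
have bDg := bounded_on_sqdist bg; have bDh := bounded_on_sqdist bh.
have bDm := bounded_on_sqdist bm.
have bD := bounded_onD bDg bDh; have bZ := bounded_onZ 2 bDm.
rewrite /sqdist -(IntD mE muE bDg bDh) -(IntZ mE muE 2 bDm) -(IntB mE muE bD bZ).
rewrite -(IntZ mE muE 2 (bounded_onB bD bZ)).
by apply: eq_Rintegral => x _; field.
Qed.

(** A minimizing sequence is Cauchy in [L2] by the parallelogram identity; with
    rate [4^-k] its increments are summable in [L1].  The functions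
    [inf_(j >= k) g j] stay in the ball since it is solid, increase to a limit
    that stays in it by Fatou's property, and are close to [g k] in [L1], hence
    almost as close to [u] as [g k] is. *)
Lemma exists_projection :
  exists g0, lower_ball g0 /\ forall g, lower_ball g -> sqdist g0 <= sqdist g.
Proof.
have D0 g : 0 <= sqdist g.
  by apply: Rintegral_ge0 => x _; exact: sqr_ge0.
pose A := [set sqdist g | g in lower_ball].
have hA : has_inf A.
  split; first by exists (sqdist (fun=> 0)), (fun=> 0) => //; exact: lower_ball0.
  by exists 0 => _ [g _ <-].
pose m := inf A.
have mle g : lower_ball g -> m <= sqdist g.
  by move=> Kg; apply: ge_inf; [exact: hA.2|exists g].
have /choice[g gP] : forall k, exists g, lower_ball g /\ sqdist g < m + (4^-1) ^+ k.
  move=> k; have e0 : 0 < (4^-1 : R) ^+ k by rewrite exprn_gt0.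
  have [_ [g Kg <-] ?] := inf_adherent e0 hA.
  by exists g.
have Kg k := (gP k).1; have bg k := lower_ball_bounded (Kg k).
have gk0 k x : 0 <= g k x by have [] := Kg k.
have gku k x : g k x <= u x by have [] := Kg k.
have mg k : measurable_fun [set: S] (g k) by have [] := Kg k.
pose t k x := `|g k.+1 x - g k x|.
have bt k : bounded_on (t k).
  have bb : bounded_on (fun x => g k.+1 x - g k x) by exact: bounded_onB.
  apply: bounded_on_le bb => [|x]; last by rewrite normr_id.
  by apply: measurableT_comp => //; exact: measurable_funB.
pose B := fine (mu E) + 4.
have B0 : 0 <= B by rewrite addr_ge0 // fine_ge0.
have It k : I (t k) <= B / (2 ^ k.+1)%:R.
  have bsq : bounded_on (fun x => (g k.+1 x - g k x) ^+ 2) by exact/bounded_on_sq/bounded_onB.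
  have b1 := bounded_on_indic mE.
  (* the arithmetic-geometric inequality turns the L2 bound on the increments
     into an L1 bound on the set E of finite measure *)
  have amgm x : t k x <= 2^-1 * ((2^-1) ^+ k * \1_E x + 2 ^+ k * (g k.+1 x - g k x) ^+ 2).
    rewrite /t indicE; case: (boolP (x \in E)) => xE /=.
      have p : 0 < (2^-1 : R) ^+ k by rewrite exprn_gt0.
      have -> : (2 : R) ^+ k = ((2^-1) ^+ k)^-1 by rewrite exprVn invrK.
      set y := g k.+1 x - g k x; set q := (2^-1) ^+ k in p *.
      rewrite -(real_normK (num_real y)) mulr1.
      have : 0 <= q^-1 * (`|y| - q) ^+ 2 by rewrite mulr_ge0 ?sqr_ge0 // invr_ge0 ltW.
      rewrite (_ : q^-1 * (`|y| - q) ^+ 2 = q + q^-1 * `|y| ^+ 2 - 2 * `|y|); first by lra.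
      by field; rewrite gt_eqF.
    have g0 j : g j x = 0.
      apply/eqP; rewrite eq_le gk0 andbT (le_trans (gku j x)) // (le_trans (uM x)) //.
      by rewrite indicE (negbTE xE) mulr0.
    by rewrite !g0 subrr normr0 mulr0 expr0n /= mulr0 addr0 mulr0.
  apply: (le_trans (Int_le mE muE _ _ amgm)) => //.
    by apply: bounded_onZ; apply: bounded_onD; exact: bounded_onZ.
  rewrite (IntZ mE muE); last by apply: bounded_onD; exact: bounded_onZ.
  rewrite (IntD mE muE); try exact: bounded_onZ.
  rewrite !(IntZ mE muE) // sqdist_parallelogram //.
  rewrite (_ : I (\1_E : S -> R) = fine (mu E)); last first.
    by rewrite /Rintegral integral_indic // setIT.
  have h1 := ltW (gP k).2; have h2 := ltW (gP k.+1).2.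
  have h3 := mle _ (lower_ball_mid (Kg k.+1) (Kg k)).
  have p2 : 0 < (2 : R) ^+ k by rewrite exprn_gt0.
  have E4 : (4^-1 : R) ^+ k = (2 ^+ k)^-1 * (2 ^+ k)^-1.
    by rewrite -exprVn -exprMn; congr (_ ^+ _); field.
  rewrite exprS E4 in h2; rewrite E4 in h1.
  rewrite natrX exprS invfM exprVn.
  set p := (2 : R) ^+ k in p2 h1 h2 *.
  have pV : p * p^-1 = 1 by rewrite divff // gt_eqF.
  have pV0 : 0 < p^-1 by rewrite invr_gt0.
  set q := p^-1 in pV pV0 h1 h2 *.
  pose Dm := sqdist (fun x => (g k.+1 x + g k x) / 2).
  have h4 : 2 * (sqdist (g k.+1) + sqdist (g k) - 2 * Dm) <= 4 * (q * q).
    by rewrite /Dm; have qq : 0 < q * q := mulr_gt0 pV0 pV0; lra.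
  have h5 : p * (2 * (sqdist (g k.+1) + sqdist (g k) - 2 * Dm)) <= 4 * q.
    rewrite (le_trans (ler_wpM2l (ltW p2) h4)) //.
    have -> : p * (4 * (q * q)) = (p * q) * (4 * q) by ring.
    by rewrite pV mul1r.
  by rewrite /B; rewrite /Dm in h5; set a := p * _ in h5 *; lra.
pose G k x := infs (g ^~ x) k.
have lbg x : has_lbound (range (g ^~ x)) by exists 0 => _ [k _ <-].
have ubg x : has_ubound (range (g ^~ x)) by exists (u x) => _ [k _ <-].
have Gle k j x : (k <= j)%N -> G k x <= g j x.
  move=> kj; apply: ge_inf; last by exists j.
  by exists 0 => _ [i _ <-].
have leG k x (r : R) : (forall j, (k <= j)%N -> r <= g j x) -> r <= G k x.
  move=> rg; apply: lb_le_inf; first by exists (g k x), k => /=.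
  by move=> _ [j /= kj <-]; exact: rg.
have G0 k x : 0 <= G k x by apply: leG.
have mG k : measurable_fun [set: S] (G k) by apply: measurable_fun_infs.
have KG k : lower_ball (G k).
  split=> //; first by move=> x; rewrite (le_trans (Gle k k x _)).
  have [_ _ _] := Kg k; apply: le_trans; apply: (nrm_le HN); try exact: nn_EFin.
  by move=> x; rewrite lee_fin Gle.
have bG k := lower_ball_bounded (KG k).
have ndG x : nondecreasing_seq (G ^~ x) by exact: nondecreasing_infs.
pose g0 x := sup (range (G ^~ x)).
have cvG x : G ^~ x @ \oo --> g0 x by apply: cvg_infs_sup.
have ubG x : has_ubound (range (G ^~ x)).
  by exists (u x) => _ [k _ <-]; rewrite (le_trans (Gle k k x _)).
have Gg0 k x : G k x <= g0 x by apply: ub_le_sup => //; exists k.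
have g0u x : g0 x <= u x.
  apply: ge_sup; first by exists (G 0%N x), 0%N.
  by move=> _ [k _ <-]; rewrite (le_trans (Gle k k x _)).
have mg0 : measurable_fun [set: S] g0 by apply: (measurable_fun_cvg mG).
have g00 x : 0 <= g0 x by rewrite (le_trans (G0 0%N x)).
have Kg0 : lower_ball g0.
  split=> //; apply: (nrm_le_lim HN (u_ := fun k => EFin \o G k)).
  - by move=> k; exact: nn_EFin.
  - exact: nn_EFin.
  - by move=> x i j ij; rewrite lee_fin; exact: ndG.
  - by move=> x; apply: cvg_EFin; [exact: nearW|exact: cvG].
  - by move=> k; have [] := KG k.
exists g0; split=> // h Kh.
suff : sqdist g0 <= m by move/le_trans; apply; exact: mle.
(* the tails of the summable increments control the distance from g k to G k *)
have tailE k x : ((g k x - G k x)%:E <= \sum_(n <oo) (t (k + n)%N x)%:E)%E.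
  have t0 n : (0 <= (t n x)%:E)%E by rewrite lee_fin /t.
  have s0 : (0 <= \sum_(n <oo) (t (k + n)%N x)%:E)%E by apply: nneseries_ge0.
  have [->|sfin] := eqVneq (\sum_(n <oo) (t (k + n)%N x)%:E)%E +oo%E; first exact: leey.
  have /fineK sE : (\sum_(n <oo) (t (k + n)%N x)%:E)%E \is a fin_num.
    by rewrite ge0_fin_numE // lt_neqAle sfin leey.
  rewrite -sE lee_fin lerBlDr -lerBlDl; apply: leG => j kj.
  rewrite lerBlDl -lerBlDr -lee_fin sE.
  apply: le_trans (nneseries_lim_ge (j - k) _) => //.
  rewrite big_mkord sumEFin lee_fin -{1}(subnKC kj).
  elim: (j - k)%N => [|n IH]; first by rewrite addn0 subrr big_ord0.
  rewrite big_ord_recr /= addnS /t.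
  have -> : g k x - g (k + n).+1 x =
    (g k x - g (k + n)%N x) + (g (k + n)%N x - g (k + n).+1 x) by ring.
  by rewrite lerD // distrC ler_norm.
have tail k : I (fun x => g k x - G k x) <= B / 2 ^+ k.
  have bgG : bounded_on (fun x => g k x - G k x) by exact: bounded_onB.
  have mt n : measurable_fun [set: S] (fun x => (t (k + n)%N x)%:E).
    by apply/measurable_EFinP; exact: (bt _).1.
  rewrite -lee_fin -(Int_EFin mE muE) //.
  apply: (@le_trans _ _ (\int[mu]_x (\sum_(n <oo) (t (k + n)%N x)%:E))%E).
    apply: ge0_le_integral => //.
    - by move=> x _; rewrite lee_fin subr_ge0 Gle.
    - by apply/measurable_EFinP; exact: bgG.1.
    - by apply: ge0_emeasurable_sum => // n x _ _; rewrite lee_fin /t.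
  rewrite integral_nneseries //; last by move=> n x _; rewrite lee_fin /t.
  have Bk : 0 <= B / 2 ^+ k by rewrite divr_ge0.
  apply: le_trans (epsilon_trick0 xpredT Bk).
  apply: lee_nneseries => [n _ _|n _].
    by apply: integral_ge0 => x _; rewrite lee_fin /t.
  rewrite (Int_EFin mE muE) // lee_fin (le_trans (It _)) //.
  by rewrite -mulrA -invfM natrX natrX -exprD addnS.
have DG k : sqdist g0 <= m + (1 + 2 * M * B) / 2 ^+ k.
  have bg0 := lower_ball_bounded Kg0.
  have bgG : bounded_on (fun x => g k x - G k x) by exact: bounded_onB.
  have b2 := bounded_onZ (2 * M) bgG.
  have bsg := bounded_on_sqdist (bg k).
  have le1 : sqdist g0 <= sqdist (g k) + 2 * M * I (fun x => g k x - G k x).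
    rewrite -(IntZ mE muE) // -(IntD mE muE) //.
    apply: (Int_le mE muE); [exact: bounded_on_sqdist|exact: bounded_onD|].
    move=> x; have h1 := Gg0 k x; have h2 := g0u x; have h3 := Gle k k x (leqnn k).
    have h4 := gku k x; have h5 := G0 k x.
    have h6 : u x <= M.
      rewrite (le_trans (uM x)) // indicE.
      by case: (_ \in _); rewrite ?mulr1 ?mulr0.
    nra.
  rewrite (le_trans le1) //.
  have h1 := ltW (gP k).2; have h2 := tail k.
  have E4 : (4^-1 : R) ^+ k <= (2 ^+ k)^-1.
    by rewrite -exprVn lerXn2r // ?nnegrE ?invr_ge0 // lef_pV2 ?posrE // ler_nat.
  have h3 : 2 * M * I (fun x => g k x - G k x) <= 2 * M * (B / 2 ^+ k).
    by rewrite ler_wpM2l // mulr_ge0.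
  have h4 : (1 + 2 * M * B) / 2 ^+ k = (2 ^+ k)^-1 + 2 * M * (B / 2 ^+ k) by ring.
  rewrite h4; lra.
rewrite leNgt; apply/negP => lt_m.
have C0 : 0 < 1 + 2 * M * B by rewrite ltr_pwDl // !mulr_ge0.
have e0 : 0 < (sqdist g0 - m) / (1 + 2 * M * B) by rewrite divr_gt0 // subr_gt0.
have [k _ /(_ k (leqnn k))] := near_infty_natSinv_expn_lt (PosNum e0).
rewrite /= ltr_pdivlMr // mulrC mul1r => hk; have := DG k; lra.
Qed.

End projection.

(** * The theorem of Lorentz and Luxemburg *)
Section separation.
Context {R : realType} {d : measure_display} {S : measurableType d}.
Variables (mu : {measure set S -> \bar R}) (N : (S -> excomplex R) -> \bar R).
Hypothesis HN : banach_function_norm mu N.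

Section bounded.
Variables (E : set S) (u : S -> R) (M c : R).
Hypotheses (mE : measurable E) (muE : (mu E < +oo)%E).
Hypotheses (meas_u : measurable_fun [set: S] u) (u0 : forall x, 0 <= u x).
Hypotheses (M0 : 0 <= M) (uM : forall x, u x <= M * \1_E x).
Hypothesis c0 : 0 < c.

Local Notation I g := (\int[mu]_x g x)%R.
Local Notation bounded_on := (@bounded_on R d S E).

(** First-order condition at the projection.  It holds against every [g] of the
    ball, also above [u]: the competitor is the minimum of [u] and the convex
    combination of [g0] and [g]. *)
Lemma projection_variational g0 g :
  lower_ball N u c g0 -> (forall h, lower_ball N u c h -> sqdist mu u g0 <= sqdist mu u h) ->
  bounded_on g -> (forall x, 0 <= g x) -> (nrm N (EFin \o g) <= c%:E)%E ->
  I (fun x => (u x - g0 x) * g x) <= I (fun x => (u x - g0 x) * g0 x).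
Proof.
move=> Kg0 g0min bg gge0 gc.
have bu : bounded_on u := bounded_on_u meas_u u0 uM.
have bg0 : bounded_on g0 := lower_ball_bounded meas_u u0 uM Kg0.
have [mg0 g00 g0u g0c] := Kg0.
have bw : bounded_on (fun x => u x - g0 x) by exact: bounded_onB.
have bd : bounded_on (fun x => g x - g0 x) by exact: bounded_onB.
have bwd : bounded_on (fun x => (u x - g0 x) * (g x - g0 x)) by exact: bounded_onM.
have bdd : bounded_on (fun x => (g x - g0 x) ^+ 2) by exact: bounded_on_sq.
have bww : bounded_on (fun x => (u x - g0 x) ^+ 2) by exact: bounded_on_sq.
rewrite -subr_le0 -(IntB mE muE); [|exact: bounded_onM|exact: bounded_onM].
have -> : I (fun x => (u x - g0 x) * g x - (u x - g0 x) * g0 x) =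
    I (fun x => (u x - g0 x) * (g x - g0 x)).
  by apply: eq_Rintegral => x _; ring.
set a := I (fun x => (u x - g0 x) * (g x - g0 x)); rewrite leNgt; apply/negP => a0.
pose q := I (fun x => (g x - g0 x) ^+ 2).
have q0 : 0 <= q by apply: Rintegral_ge0 => x _; exact: sqr_ge0.
have ineq t : 0 <= t <= 1 -> 2 * t * a <= t ^+ 2 * q.
  move=> t01; pose gt x := (1 - t) * g0 x + t * g x.
  have bgt : bounded_on gt by apply: bounded_onD; exact: bounded_onZ.
  have mgt : measurable_fun [set: S] gt := bgt.1.
  have gt0 x : 0 <= gt x.
    by case/andP: t01 => t0 t1; rewrite addr_ge0 // mulr_ge0 // subr_ge0.
  have gtc : (nrm N (EFin \o gt) <= c%:E)%E.
    by apply: (nrm_convex HN) => //; apply: nn_EFin => //; exact: bg.1.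
  pose h x := Num.min (gt x) (u x).
  have mh : measurable_fun [set: S] h by exact: measurable_minr.
  have h0 x : 0 <= h x by rewrite le_min gt0 u0.
  have Kh : lower_ball N u c h.
    split=> //; first by move=> x; rewrite ge_min lexx orbT.
    apply: le_trans gtc; apply: (nrm_le HN); try exact: nn_EFin.
    by move=> x; rewrite lee_fin ge_min lexx.
  have bh : bounded_on h by exact: lower_ball_bounded Kh.
  have le1 : sqdist mu u g0 <= I (fun x => (u x - gt x) ^+ 2).
    apply: le_trans (g0min _ Kh) _; apply: (Int_le mE muE).
    - exact: bounded_on_sqdist bh.
    - exact: bounded_on_sqdist bgt.
    move=> x; rewrite /h /Num.min; case: ifP => // /negbT; rewrite -leNgt => ugt.
    by rewrite subrr expr0n /= sqr_ge0.
  have E1 : I (fun x => (u x - gt x) ^+ 2) = sqdist mu u g0 - 2 * t * a + t ^+ 2 * q.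
    rewrite /sqdist /a /q -(IntZ mE muE (2 * t)) // -(IntZ mE muE (t ^+ 2)) //.
    have bZ := bounded_onZ (2 * t) bwd; have bZ' := bounded_onZ (t ^+ 2) bdd.
    rewrite -(IntB mE muE bww bZ) -(IntD mE muE (bounded_onB bww bZ) bZ').
    by apply: eq_Rintegral => x _; rewrite /gt; ring.
  by move: le1; rewrite E1; lra.
(* for small t the linear term dominates the quadratic one *)
have aq : 0 < a + q by rewrite ltr_pwDl.
pose t := a / (a + q).
have t0 : 0 < t by rewrite divr_gt0.
have t1 : t <= 1 by rewrite ler_pdivrMr // mul1r lerDl.
have tq : t * q <= a by rewrite /t mulrAC ler_pdivrMr // ler_wpM2l ?lerDr // ltW.
have h : t ^+ 2 * q <= t * a by rewrite expr2 -mulrA ler_wpM2l // ltW.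
have ta : 0 < t * a by rewrite mulr_gt0.
have /ineq : 0 <= t <= 1 by rewrite ltW.
lra.
Qed.

(** The residual [u - g0] is bounded on the ball of radius [c] by its value [b]
    at [g0], while its value at [u] is [b + s] with [s] its squared [L2] norm;
    [s] is positive, otherwise [u] itself would lie in the ball.  Rescaling by
    [c / (b + s)] puts it in the dual ball. *)
Lemma separation_bounded : (c%:E < nrm N (EFin \o u))%E ->
  exists w, dual_ball mu N w /\ (c%:E <= pairing mu (EFin \o u) w)%E.
Proof.
move=> cu.
have [g0 [Kg0 g0min]] := exists_projection HN mE muE meas_u u0 M0 uM c0.
have bu : bounded_on u := bounded_on_u meas_u u0 uM.
have bg0 : bounded_on g0 := lower_ball_bounded meas_u u0 uM Kg0.
have [mg0 g00 g0u g0c] := Kg0.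
pose w x := u x - g0 x.
have bw : bounded_on w by exact: bounded_onB.
have w0 x : 0 <= w x by rewrite subr_ge0.
have nw : nnmeasurable (EFin \o w) by apply: nn_EFin => //; exact: bw.1.
pose b := I (fun x => w x * g0 x); pose s := I (fun x => w x ^+ 2).
have bwg0 : bounded_on (fun x => w x * g0 x) by exact: bounded_onM.
have bw2 : bounded_on (fun x => w x ^+ 2) by exact: bounded_on_sq.
have b0 : 0 <= b by apply: Rintegral_ge0 => x _; rewrite mulr_ge0.
have s0 : 0 < s.
  rewrite lt_neqAle Rintegral_ge0 ?andbT; last by move=> x _; exact: sqr_ge0.
  apply/negP => /eqP s0.
  have mw2 : measurable_fun [set: S] (EFin \o (fun x => w x ^+ 2)).
    by apply/measurable_EFinP; exact: bw2.1.
  have [/(_ _) ae0 _] := ae_eq_integral_abs mu measurableT mw2.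
  move: cu; rewrite ltNge => /negP; apply; apply: le_trans g0c.
  apply: (nrm_le_ae HN); [exact: nn_EFin|exact: nn_EFin|].
  have : ae_eq mu setT (EFin \o (fun x => w x ^+ 2)) (cst 0%E).
    apply: ae0; rewrite -[RHS]/(0%:E) s0 -(Int_EFin mE muE) //.
    by apply: eq_integral => x _; rewrite gee0_abs // lee_fin sqr_ge0.
  apply: filterS => x /(_ Logic.I) /= /eqP.
  by rewrite eqe sqrf_eq0 subr_eq0 => /eqP ->.
have bs : 0 < b + s by rewrite ltr_wpDl.
have Eu : I (fun x => w x * u x) = b + s.
  rewrite /b /s -(IntD mE muE) //.
  by apply: eq_Rintegral => x _; rewrite /w; ring.
exists (fun x => ((c / (b + s))%:E * (w x)%:E)%E).
have cbs : 0 <= c / (b + s) by rewrite divr_ge0 ?ltW.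
split; last first.
  rewrite pairingC pairingZ //; last exact: nn_EFin.
  rewrite /pairing (_ : (\int[mu]_x _)%E = (b + s)%:E).
    by rewrite -EFinM lee_fin -mulrA mulVf ?mulr1 // gt_eqF.
  rewrite -Eu -(Int_EFin mE muE); first by apply: eq_integral => x _; rewrite EFinM.
  exact: bounded_onM.
split; first exact: nnZ.
move=> v nv v1; rewrite pairingC pairingZ //.
have ncv : nnmeasurable (fun x => c%:E * v x)%E by apply: nnZ => //; exact: ltW.
suff H : (pairing mu (fun x => c%:E * v x) (EFin \o w) <= b%:E)%E.
  move: H; rewrite (pairingZ mu (ltW c0)) // pairingC => H.
  rewrite (_ : c / (b + s) = (b + s)^-1 * c); last by rewrite mulrC.
  rewrite EFinM -muleA.
  apply: le_trans (lee_wpmul2l _ H) _; first by rewrite lee_fin invr_ge0 ltW.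
  by rewrite -EFinM lee_fin mulrC ler_pdivrMr // mul1r lerDl ltW.
pose cv := (fun x => c%:E * v x)%E.
have cv0 x : (0 <= cv x)%E by exact: ncv.2.
have ndE : nondecreasing_seq (fun _ : nat => E) by [].
have nt k : nnmeasurable (trunc cv (fun=> E) k) by exact: nn_trunc.
apply: (pairing_le_lim (u_ := fun k => trunc cv (fun=> E) k)) => //.
- by move=> x; exact: trunc_nd.
- move=> x wx; apply: trunc_cvg => //; exists 0%N.
  apply: contrapT => xE; move/negP: wx; apply.
  have := uM x; have := g0u x; have := g00 x.
  rewrite indicE memNset // mulr0 => h1 h2 h3.
  by rewrite /w /= eqe; apply/eqP; lra.
move=> k; pose g x := fine (trunc cv (fun=> E) k x).
have Eg : EFin \o g = trunc cv (fun=> E) k.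
  by apply/funext => x; rewrite /g /= fineK // trunc_fin_num.
have g0' x : 0 <= g x by rewrite fine_ge0 // trunc_ge0.
have mg : measurable_fun [set: S] g by apply/measurable_EFinP; rewrite Eg; exact: (nt k).1.
have bg : bounded_on g.
  split=> //; exists k%:R => x; rewrite ger0_norm // -lee_fin.
  by rewrite [(g x)%:E](congr1 (@^~ x) Eg) trunc_bound.
have gc : (nrm N (EFin \o g) <= c%:E)%E.
  rewrite Eg; apply: (@le_trans _ _ (nrm N cv)).
    by apply: (nrm_le HN) => // x; exact: trunc_le.
  by rewrite (nrmZ HN (ltW c0)) // -[leRHS]mule1 lee_wpmul2l // lee_fin ltW.
rewrite -Eg (_ : pairing _ _ _ = (I (fun x => w x * g x))%:E).
  by rewrite lee_fin; exact: projection_variational.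
rewrite -(Int_EFin mE muE); last exact: bounded_onM.
by apply: eq_integral => x _; rewrite /= -EFinM mulrC.
Qed.

End bounded.

(** Lorentz--Luxemburg: the norm is the supremum of the pairings with the dual
    ball.  By Fatou's property it is enough to treat the truncations of [u]. *)
Lemma nrm_le_dual (u : S -> \bar R) (c : \bar R) : sigma_finite [set: S] mu ->
  nnmeasurable u -> (0 <= c)%E ->
  (forall w, dual_ball mu N w -> (pairing mu u w <= c)%E) -> (nrm N u <= c)%E.
Proof.
move=> /sigma_finiteP[F [FT ndF Fm]] nu c0 dual_c.
have Fx x : exists k, F k x by have : [set: S] x by []; rewrite FT => -[k _ ?]; exists k.
have nt k : nnmeasurable (trunc u F k) by apply: nn_trunc => //; exact: (Fm k).1.
apply: (nrm_le_lim HN (u_ := fun k => trunc u F k)) => //.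
- by move=> x; apply: trunc_nd => //; exact: nu.2.
- by move=> x; apply: trunc_cvg => //; exact: nu.2.
move=> k; case: c c0 dual_c => [c| |//]; last by move=> _ _; exact: leey.
rewrite lee_fin => c0 dual_c; apply/lee_addgt0Pr => e e0.
rewrite leNgt; apply/negP => ce.
pose g x := fine (trunc u F k x).
have Eg : EFin \o g = trunc u F k.
  by apply/funext => x; rewrite /g /= fineK // trunc_fin_num //; exact: nu.2.
have g0 x : 0 <= g x by rewrite fine_ge0 // trunc_ge0 //; exact: nu.2.
have mg : measurable_fun [set: S] g by apply/measurable_EFinP; rewrite Eg; exact: (nt k).1.
have gF x : g x <= k%:R * \1_(F k) x.
  by rewrite -lee_fin [(g x)%:E](congr1 (@^~ x) Eg) trunc_bound.
have ce0 : 0 < c + e by rewrite ltr_wpDl.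
have [||w [dw]] := @separation_bounded (F k) g k%:R (c + e) (Fm k).1 (Fm k).2 mg g0 _ gF ce0.
  exact: ler0n.
  by rewrite Eg EFinD.
rewrite Eg leNgt => /negP; apply.
apply: (@le_lt_trans _ _ c%:E); last by rewrite lte_fin ltrDl.
apply: le_trans (dual_c _ dw); apply: pairing_le => //; first exact: dw.1.
by move=> x; exact: trunc_le nu.2.
Qed.

End separation.

(** * Rearrangements *)
Section rearrangements.
Context {R : realType} {d : measure_display} {S : measurableType d}.
Variable mu : {measure set S -> \bar R}.
Implicit Types u v : S -> \bar R.
Local Open Scope ereal_scope.

Definition distr u (s : R) : \bar R := mu [set x | s%:E < u x].

Definition rear u (t : R) : \bar R :=
  ereal_inf [set s%:E | s in [set s : R | (0 <= s)%R /\ distr u s <= t%:E]].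

Definition rpair u v : \bar R :=
  \int[@lebesgue_measure R]_(t in `[0%R, +oo[) (rear u t * rear v t).

Lemma rearrangementE f : rearrangement mu f = rear (excabsfun f).
Proof. by []. Qed.

Lemma rearrangement_pairingE f g :
  rearrangement_pairing mu f g = rpair (excabsfun f) (excabsfun g).
Proof. by []. Qed.

Lemma measurable_gt u (s : R) : nnmeasurable u -> measurable [set x | s%:E < u x].
Proof. by move=> nu; have := emeasurable_fun_o_infty measurableT nu.1 s%:E; rewrite setTI. Qed.

Lemma distr_le u (s s' : R) : nnmeasurable u -> (s <= s')%R -> distr u s' <= distr u s.
Proof.
move=> nu ss; apply: le_measure; rewrite ?inE; try exact: measurable_gt.
by move=> x /=; apply: le_lt_trans; rewrite lee_fin.
Qed.

Lemma distr_mono u v (s : R) : nnmeasurable u -> nnmeasurable v ->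
  (forall x, u x <= v x) -> distr u s <= distr v s.
Proof.
move=> nu nv uv; apply: le_measure; rewrite ?inE; try exact: measurable_gt.
by move=> x /= /lt_le_trans; apply.
Qed.

Lemma distr_charfun (E : set S) (s : R) : (0 <= s)%R ->
  distr (charfun E) s = if (s < 1)%R then mu E else 0.
Proof.
move=> s0; rewrite /distr (_ : [set x | _] = if (s < 1)%R then E else set0).
  by case: ifP => // _; rewrite measure0.
apply/seteqP; split => x; rewrite /charfun /= lte_fin indicE.
  case: (boolP (x \in E)) => [/set_mem xE|_] /=; first by move=> ->.
  by rewrite ltNge s0.
by case: ifP => // s1 Ex; rewrite mem_set.
Qed.

Lemma rear_ge0 u t : 0 <= rear u t.
Proof. by apply: le_ereal_inf_tmp => _ [s [s0 _] <-]; rewrite lee_fin. Qed.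

Lemma rear_nincr u t t' : (t <= t')%R -> rear u t' <= rear u t.
Proof.
move=> tt; apply: ereal_inf_le_tmp; apply: image_subset => s [s0 st]; split=> //.
by rewrite (le_trans st) // lee_fin.
Qed.

Lemma rear_dilate u v (C t : R) : (0 < C)%R ->
  (forall s, (0 <= s)%R -> distr u s <= C%:E * distr v s) ->
  rear u t <= rear v (t / C).
Proof.
move=> C0 uv; apply: ereal_inf_le_tmp; apply: image_subset => s [s0 st]; split=> //.
rewrite (le_trans (uv s s0)) //.
apply: (@le_trans _ _ (C%:E * (t / C)%:E)).
  by rewrite lee_wpmul2l // lee_fin ltW.
by rewrite -EFinM lee_fin mulrC divfK // gt_eqF.
Qed.

(** The bound on [distr] is asked only for levels strictly below [a], so that it
    applies to characteristic functions with [a = 1]. *)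
Lemma rear_lower u (a T t : R) : (forall s, (0 <= s < a)%R -> T%:E <= distr u s) ->
  (t < T)%R -> a%:E <= rear u t.
Proof.
move=> Tu tT; apply: le_ereal_inf_tmp => _ [s [s0 st] <-]; rewrite lee_fin leNgt.
apply/negP => sa; have sa' : (0 <= s < a)%R by rewrite s0.
by have := le_trans (Tu s sa') st; rewrite lee_fin leNgt tT.
Qed.

(** Galois connection between a function and its distribution function; the
    direct implication is right continuity of [distr u], obtained from
    continuity of the measure along increasing unions. *)
Lemma rear_leP u (s t : R) : nnmeasurable u -> (0 <= s)%R ->
  (rear u t <= s%:E) <-> (distr u s <= t%:E).
Proof.
move=> nu s0; split=> [ust|ut]; last by apply: ereal_inf_lbound; exists s.
pose F n := [set x | (s + n.+1%:R^-1)%:E < u x].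
have mF n : measurable (F n) by exact: measurable_gt.
have UF : [set x | s%:E < u x] = \bigcup_n F n.
  apply/seteqP; split => [x /= sx|x [n _] /=]; last first.
    by apply: le_lt_trans; rewrite lee_fin lerDl.
  move: sx; case E : (u x) => [r| |//] sx.
    have e0 : (0 < r - s)%R by rewrite subr_gt0 -lte_fin.
    have [k _ /(_ k (leqnn k)) /= hk] := near_infty_natSinv_lt (PosNum e0).
    by exists k => //; rewrite /F /= E lte_fin -ltrBrDl.
  by exists 0%N => //; rewrite /F /= E ltry.
have ndF : nondecreasing_seq F.
  move=> i j ij; apply/subsetPset => x; apply: le_lt_trans.
  by rewrite lee_fin lerD2l lef_pV2 ?posrE // ler_nat.
have cvF := nondecreasing_cvg_mu (mu := mu) mF (bigcup_measurable (fun n _ => mF n)) ndF.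
rewrite /distr UF -(cvg_lim _ cvF) //; apply: lime_le; first exact: cvgP cvF.
apply: nearW => n /=.
have : rear u t < (s + n.+1%:R^-1)%:E by rewrite (le_lt_trans ust) // lte_fin ltrDl.
move=> /ereal_inf_lt[_ [s' [s'0 s't] <-]]; rewrite lte_fin => s'n.
by apply: le_trans s't; apply: distr_le => //; exact: ltW.
Qed.

Definition equi u v := forall t : R, (0 <= t)%R -> rear u t = rear v t.

Lemma equi_distr_le u v (s : R) : nnmeasurable u -> nnmeasurable v -> equi u v ->
  (0 <= s)%R -> distr u s <= distr v s.
Proof.
move=> nu nv uv s0; case E : (distr v s) => [r| |]; last 2 first.
- exact: leey.
- by have : 0 <= distr v s := measure_ge0 mu _; rewrite E.
have r0 : (0 <= r)%R by have : 0 <= distr v s := measure_ge0 mu _; rewrite E lee_fin.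
by apply/(rear_leP r nu s0); rewrite uv //; apply/rear_leP => //; rewrite E.
Qed.

(** The rearrangement is monotone, so its superlevel sets are intervals. *)
Lemma measurable_rear u : measurable_fun [set: R] (rear u : measurableTypeR R -> \bar R).
Proof.
apply: (measurability _ (ErealGenOInfty.measurableE R)).
move=> /= _ [_ [a ->]] <-; apply: measurableI => //.
apply: is_interval_measurable => x y /=; rewrite !in_itv /= !andbT.
move=> ax ay z /andP[xz zy]; rewrite in_itv /= andbT.
by apply: (lt_le_trans ay); exact: rear_nincr.
Qed.

Let measurable_rear_mul u v : measurable_fun (`[0%R, +oo[%classic : set (measurableTypeR R))
  (fun t : measurableTypeR R => rear u t * rear v t).
Proof. by apply: measurable_funTS; apply: emeasurable_funM; exact: measurable_rear. Qed.

Let rear_mul_ge0 u v t : 0 <= rear u t * rear v t.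
Proof. by rewrite mule_ge0 ?rear_ge0. Qed.

Lemma rpairC u v : rpair u v = rpair v u.
Proof. by apply: eq_integral => t _; rewrite muleC. Qed.

Lemma rpair_le u u' v v' : (forall t, (0 <= t)%R -> rear u t <= rear u' t) ->
  (forall t, (0 <= t)%R -> rear v t <= rear v' t) -> rpair u v <= rpair u' v'.
Proof.
move=> uu vv; apply: ge0_le_integral => // t; rewrite /= in_itv /= andbT => t0.
by apply: lee_pmul; rewrite ?rear_ge0 ?uu ?vv.
Qed.

Lemma rpair_equi u u' v : equi u u' -> rpair u v = rpair u' v.
Proof.
move=> uu; apply: eq_integral => t; rewrite inE /= in_itv /= andbT => t0.
by rewrite uu.
Qed.

Lemma rpair_lower u v (a b T : R) : (0 <= a)%R -> (0 <= b)%R -> (0 <= T)%R ->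
  (forall s, (0 <= s < a)%R -> T%:E <= distr u s) ->
  (forall s, (0 <= s < b)%R -> T%:E <= distr v s) ->
  (a * b * T)%:E <= rpair u v.
Proof.
move=> a0 b0 T0 aT bT.
apply: (@le_trans _ _ (\int[@lebesgue_measure R]_(t in `[0%R, T[) (a * b)%:E)).
  rewrite integral_cst //= lebesgue_measure_itv /= lte_fin.
  case: ltP => [_|T0']; first by rewrite oppr0 addr0 -EFinM.
  by rewrite mule0 (_ : T = 0%R) ?mulr0 //; apply/eqP; rewrite eq_le T0 T0'.
apply: (@le_trans _ _ (\int[@lebesgue_measure R]_(t in `[0%R, T[) (rear u t * rear v t))).
  apply: ge0_le_integral => //.
  - by move=> t _; rewrite lee_fin mulr_ge0.
  - apply: measurable_funS (measurable_rear_mul u v) => // t /=.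
    by rewrite !in_itv /= andbT => /andP[].
  move=> t; rewrite /= in_itv /= => /andP[t0 tT].
  by rewrite EFinM lee_pmul ?lee_fin //; exact: rear_lower tT.
apply: ge0_subset_integral => //.
by move=> t /=; rewrite !in_itv /= andbT => /andP[].
Qed.

End rearrangements.

(** * Dilations of the half-line *)
Section lebesgue_dilation.
Context {R : realType}.
Local Open Scope ereal_scope.
Local Notation leb := (@lebesgue_measure R).

Definition dilation (C : R) (t : measurableTypeR R) : measurableTypeR R := (t / C)%R.

Lemma measurable_dilation C : measurable_fun [set: measurableTypeR R] (dilation C).
Proof. exact: mulrr_measurable. Qed.

(** The image of Lebesgue measure under [t / C], packed with the proof that it
    is a measure. *)
Definition dilated_lebesgue (C : R) : {measure set (measurableTypeR R) -> \bar R} :=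
  measure_function_pushforward__canonical__measure_function_Measure leb
    (measurable_dilation C).

Lemma lebesgue_measure_dilation (C : {posnum R}) (A : set R) : measurable A ->
  leb A = mscale ((C%:num^-1)%:nng)%R (dilated_lebesgue C%:num) A.
Proof.
apply: lebesgue_measure_unique => _ [[a b] _ <-].
rewrite /= /mscale /= /pushforward.
rewrite (_ : _ @^-1` _ = `](a * C%:num)%R, (b * C%:num)%R]%classic).
  rewrite !lebesgue_measure_itv /= !lte_fin ltr_pM2r //.
  case: ifP => _; last by rewrite mule0.
  by rewrite -!EFinB -EFinM -mulrBl mulrCA mulVf ?mulr1 // gt_eqF.
by apply/seteqP; split => t /=; rewrite !in_itv /= /dilation ltr_pdivlMr // ler_pdivrMr.
Qed.

Lemma integral_dilation (C : R) (f : R -> \bar R) : (0 < C)%R ->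
  measurable_fun [set: measurableTypeR R] f -> (forall t, 0 <= f t) ->
  \int[leb]_(t in `[0%R, +oo[) f (t / C)%R = C%:E * \int[leb]_(t in `[0%R, +oo[) f t.
Proof.
move=> C0 mf f0.
have mD : measurable_fun (`[0%R, +oo[%classic : set (measurableTypeR R))
    (f : measurableTypeR R -> _).
  exact: measurable_funTS.
rewrite [in RHS](eq_measure_integral
  (mscale (((PosNum C0)%:num^-1)%:nng)%R (dilated_lebesgue C))); last first.
  by move=> A mA _; exact: (lebesgue_measure_dilation (PosNum C0)).
rewrite ge0_integral_mscale //= muleA -EFinM divff ?gt_eqF // mul1e.
rewrite ge0_integral_pushforward //; last exact: measurable_dilation.
rewrite (_ : dilation C @^-1` _ = `[0%R, +oo[%classic) //.
by apply/seteqP; split => t /=; rewrite !in_itv /= !andbT /dilation pmulr_lge0 // invr_gt0.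
Qed.

End lebesgue_dilation.

(** * Duality through rearrangements *)
Section resonance.
Context {R : realType} {d : measure_display} {S : measurableType d}.
Variables (mu : {measure set S -> \bar R}) (N : (S -> excomplex R) -> \bar R).
Hypothesis Hres : resonant mu.
Implicit Types u v w h : S -> \bar R.
Local Open Scope ereal_scope.

Lemma abs_pairingE f g : abs_pairing mu f g = pairing mu (excabsfun f) (excabsfun g).
Proof. by apply: eq_integral => x _; exact: excabsM. Qed.

Lemma resonant_sup u v : nnmeasurable u -> nnmeasurable v ->
  ereal_sup [set abs_pairing mu (excnnfun u) h | h in
    [set h | excmeasurable h /\ equimeasurable mu h (excnnfun v)]] = rpair mu u v.
Proof.
move=> nu nv; rewrite Hres.2; try exact: excmeasurable_nn.
by rewrite rearrangement_pairingE (excabsfun_nn nu.2) (excabsfun_nn nv.2).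
Qed.

(** The inequality of Hardy and Littlewood: [v] is one of its equimeasurable
    rearrangements. *)
Lemma hardy_littlewood u v : nnmeasurable u -> nnmeasurable v ->
  pairing mu u v <= rpair mu u v.
Proof.
move=> nu nv; rewrite -resonant_sup //; apply: ereal_sup_ubound.
exists (excnnfun v); first by split => //; exact: excmeasurable_nn.
by rewrite abs_pairingE (excabsfun_nn nu.2) (excabsfun_nn nv.2).
Qed.

Lemma equi_nn u v : nnmeasurable u -> nnmeasurable v -> equi mu u v ->
  equimeasurable mu (excnnfun u) (excnnfun v).
Proof.
move=> nu nv uv t t0.
by rewrite !rearrangementE (excabsfun_nn nu.2) (excabsfun_nn nv.2) uv.
Qed.

Lemma rpair_leP u v (c : \bar R) : nnmeasurable u -> nnmeasurable v ->
  (forall h, nnmeasurable h -> equi mu h v -> pairing mu u h <= c) -> rpair mu u v <= c.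
Proof.
move=> nu nv hc; rewrite -resonant_sup //; apply: ge_ereal_sup => _ [h [mh hv] <-].
rewrite abs_pairingE (excabsfun_nn nu.2); apply: hc; first exact: nn_excabs.
by move=> t t0; have := hv t t0; rewrite !rearrangementE (excabsfun_nn nv.2).
Qed.

Lemma rpair_gt u v (c : \bar R) : nnmeasurable u -> nnmeasurable v -> c < rpair mu u v ->
  exists h, [/\ nnmeasurable h, equi mu h v & c < pairing mu u h].
Proof.
move=> nu nv cuv; apply: contrapT => noh; move: cuv; rewrite ltNge => /negP; apply.
apply: rpair_leP => // h nh hv; rewrite leNgt; apply/negP => ch.
by apply: noh; exists h.
Qed.

(** Subadditivity of the norms that define the topology [xi].  Rearrangement is
    not additive, but resonance exhibits the left-hand side as a supremum of
    pairings, which are. *)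
Lemma rpairD u u' w : nnmeasurable u -> nnmeasurable u' -> nnmeasurable w ->
  rpair mu (fun x => u x + u' x) w <= rpair mu u w + rpair mu u' w.
Proof.
move=> nu nu' nw; apply: rpair_leP => //; first exact: nnD.
move=> h nh hw; rewrite pairingD //; apply: leeD.
  by rewrite (rpairC _ u) -(rpair_equi _ hw) rpairC; exact: hardy_littlewood.
by rewrite (rpairC _ u') -(rpair_equi _ hw) rpairC; exact: hardy_littlewood.
Qed.

Hypothesis HN : banach_function_norm mu N.
Hypothesis HRI : rearrangement_invariant mu N.

Lemma nrm_equi u v : nnmeasurable u -> nnmeasurable v -> equi mu u v -> nrm N u = nrm N v.
Proof.
by move=> nu nv uv; apply: HRI; try exact: excmeasurable_nn; exact: equi_nn.
Qed.

(** Hoelder's inequality.  Normalizing by [nrm N u + e] avoids a separate case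
    for the null functions. *)
Lemma pairing_le_nrm u w : nnmeasurable u -> dual_ball mu N w -> pairing mu u w <= nrm N u.
Proof.
move=> nu [nw dw]; have := nrm_ge0 HN nu.
case E : (nrm N u) => [r| |] //; last by move=> _; rewrite leey.
rewrite lee_fin => r0; apply/lee_addgt0Pr => e e0.
have re : (0 < r + e)%R by rewrite ltr_wpDl.
have ire : (0 <= (r + e)^-1)%R by rewrite invr_ge0 ltW.
have : pairing mu (fun x => (r + e)^-1%:E * u x) w <= 1.
  apply: dw; first exact: nnZ.
  by rewrite (nrmZ HN) // E -EFinM lee_fin mulrC ler_pdivrMr // mul1r lerDl ltW.
by rewrite pairingZ // muleC lee_pdivrMr // mul1e EFinD.
Qed.

(** The associate norm is rearrangement-invariant as well. *)
Lemma dual_ball_equi w h : dual_ball mu N w -> nnmeasurable h -> equi mu h w ->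
  dual_ball mu N h.
Proof.
move=> [nw dw] nh hw; split=> // v nv v1.
apply: (le_trans (hardy_littlewood nv nh)).
rewrite rpairC (rpair_equi _ hw); apply: rpair_leP => // v' nv' vv'.
by rewrite pairingC; apply: dw => //; rewrite (nrm_equi nv' nv).
Qed.

Lemma rpair_le_nrm u w : nnmeasurable u -> dual_ball mu N w -> rpair mu u w <= nrm N u.
Proof.
move=> nu dw; apply: rpair_leP => //; first exact: dw.1.
by move=> h nh hw; apply: pairing_le_nrm => //; exact: dual_ball_equi hw.
Qed.

Lemma nrm_le_rpair u (c : \bar R) : nnmeasurable u -> 0 <= c ->
  (forall w, dual_ball mu N w -> rpair mu u w <= c) -> nrm N u <= c.
Proof.
move=> nu c0 hc; apply: (nrm_le_dual HN Hres.1) => // w dw.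
by apply: le_trans (hc _ dw); apply: hardy_littlewood => //; exact: dw.1.
Qed.

(** The comparison principle: [rear u t <= rear v (t / C)], and since
    [t / C <= t] the other factor may be replaced by [rear w (t / C)] too; the
    substitution then produces the factor [C]. *)
Lemma nrm_distr u v (C : R) : (1 <= C)%R -> nnmeasurable u -> nnmeasurable v ->
  (forall s, (0 <= s)%R -> distr mu u s <= C%:E * distr mu v s) ->
  nrm N u <= C%:E * nrm N v.
Proof.
move=> C1 nu nv uv; have C0 : (0 < C)%R by rewrite (lt_le_trans _ C1).
have Cn : 0 <= C%:E * nrm N v.
  by apply: mule_ge0; [rewrite lee_fin ltW|exact: (nrm_ge0 HN nv)].
apply: nrm_le_rpair => // w dw.
apply: (@le_trans _ _ (C%:E * rpair mu v w)); last first.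
  by apply: lee_wpmul2l; [rewrite lee_fin ltW|exact: rpair_le_nrm].
have mvw : measurable_fun [set: measurableTypeR R] (fun t => rear mu v t * rear mu w t).
  by apply: emeasurable_funM; exact: measurable_rear.
rewrite /rpair -integral_dilation // => [|t]; last by rewrite mule_ge0 ?rear_ge0.
have mI w1 w2 : measurable_fun (`[0%R, +oo[%classic : set (measurableTypeR R))
    (fun t : measurableTypeR R => rear mu w1 t * rear mu w2 t).
  by apply: measurable_funTS; apply: emeasurable_funM; exact: measurable_rear.
apply: ge0_le_integral => //.
- by move=> t _; rewrite mule_ge0 ?rear_ge0.
- apply: measurable_funTS; apply: (measurableT_comp mvw).
  exact: measurable_dilation.
move=> t; rewrite /= in_itv /= andbT => t0.
apply: lee_pmul; rewrite ?rear_ge0 //; first exact: rear_dilate.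
by apply: rear_nincr; rewrite ler_pdivrMr // ler_peMr.
Qed.

Lemma nrm_charfun_le (C : R) (E F : set S) : (1 <= C)%R -> measurable E -> measurable F ->
  mu E <= C%:E * mu F -> nrm N (charfun E) <= C%:E * nrm N (charfun F).
Proof.
move=> C1 mE mF EF; apply: nrm_distr => //; try exact: nn_charfun.
move=> s s0; rewrite !distr_charfun //; case: ifP => // _; by rewrite mule0.
Qed.

End resonance.

(** * Characteristic functions of small sets *)
Section smallness.
Context {R : realType} {d : measure_display} {S : measurableType d}.
Variables (mu : {measure set S -> \bar R}) (N : (S -> excomplex R) -> \bar R).
Hypotheses (Hres : resonant mu) (HN : banach_function_norm mu N).
Hypothesis HRI : rearrangement_invariant mu N.
Implicit Types (f : S -> excomplex R) (u v w : S -> \bar R) (E F G : set S).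
Local Open Scope ereal_scope.

Lemma excabs_restr f (E : set S) x :
  excabsfun (excrestr f E) x = excabsfun f x * charfun E x.
Proof.
rewrite /excabsfun /= excrestrE /charfun indicE; case: (x \in E).
  by rewrite mule1.
by rewrite mule0 excabs_real normr0.
Qed.

Lemma nrm_restr f (E : set S) : excmeasurable f -> measurable E ->
  N (excrestr f E) = nrm N (fun x => excabsfun f x * charfun E x).
Proof.
move=> mf mE; rewrite (nrmE HN); last exact: excmeasurable_restr.
by congr (nrm N _); apply/funext => x; exact: excabs_restr.
Qed.

Lemma nrm_eq0_ae u : nnmeasurable u -> (forall s : R, (0 < s)%R -> distr mu u s = 0) ->
  nrm N u = 0.
Proof.
move=> nu u0; apply/(bfn_eq0 HN nu).
exists (\bigcup_n [set x | n.+1%:R^-1%:E < u x]); split.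
- by apply: bigcup_measurable => n _; exact: measurable_gt.
- apply/negligibleP; first by apply: bigcup_measurable => n _; exact: measurable_gt.
  apply: negligible_bigcup => n; apply/negligibleP; first exact: measurable_gt.
  exact: u0.
move=> x /= /eqP ux; have u0x : 0 < u x by rewrite lt_neqAle eq_sym ux nu.2.
move: u0x; case E : (u x) => [r| |//] r0; last by exists 0%N => //=; rewrite E ltry.
have [k _ /(_ k (leqnn k)) /= hk] := near_infty_natSinv_lt (PosNum r0).
by exists k => //=; rewrite E lte_fin.
Qed.

Lemma nrm_set0 : nrm N (charfun (set0 : set S)) = 0.
Proof.
apply: nrm_eq0_ae; first exact: nn_charfun.
by move=> s s0; rewrite distr_charfun ?ltW // measure0; case: ifP.
Qed.

(** A substitute for the choice of subsets of prescribed measure, valid without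
    distinguishing nonatomic from atomic spaces.  Resonance applied to the
    characteristic functions of [F] and [E] yields [h] equimeasurable with that
    of [E] whose integral over [F] exceeds half of [mu E]; as [h <= 1] almost
    everywhere, the part of [F] where [h] is positive is large enough. *)
Lemma equimeasurable_subset (F E : set S) : measurable F -> measurable E ->
  0 < mu E < +oo -> mu E <= mu F ->
  exists G, [/\ measurable G, G `<=` F, mu G <= mu E & mu E <= 2%:E * mu G].
Proof.
move=> mF mE /andP[E0 Efin] EF.
have [r Er] : exists r, mu E = r%:E.
  by exists (fine (mu E)); rewrite fineK // ge0_fin_numE.
have r0 : (0 < r)%R by rewrite -lte_fin -Er.
have nF : nnmeasurable (charfun F : S -> \bar R) by exact: nn_charfun.
have nE : nnmeasurable (charfun E : S -> \bar R) by exact: nn_charfun.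
have : (r / 2)%:E < rpair mu (charfun F) (charfun E).
  apply: (@lt_le_trans _ _ (1 * 1 * r)%:E); first by rewrite lte_fin; lra.
  by apply: rpair_lower; rewrite ?ltW // => s /andP[s0 s1]; rewrite distr_charfun // s1 -Er.
move=> /(rpair_gt Hres nF nE)[h [nh hE]] ltp.
pose G := F `&` [set x | 0%R%:E < h x].
have mG : measurable G by apply: measurableI => //; exact: measurable_gt.
exists G; split=> //.
- by move=> x [].
- apply: (@le_trans _ _ (distr mu h 0)).
    by apply: le_measure; rewrite ?inE //; [exact: measurable_gt|by move=> x []].
  by have := equi_distr_le nh nE hE (lexx 0%R); rewrite distr_charfun // ltr01.
have h1 : {ae mu, forall x, h x <= 1}.
  exists [set x | 1%R%:E < h x]; split; first exact: measurable_gt.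
    apply/eqP; rewrite eq_le measure_ge0 andbT.
    by have := equi_distr_le nh nE hE ler01; rewrite distr_charfun // ltxx.
  by move=> x /= /negP; rewrite -ltNge.
have : pairing mu (charfun F) h <= mu G.
  rewrite -(setIT G) -integral_indic //.
  apply: ae_ge0_le_integral => //.
  - by move=> x _; rewrite mule_ge0 ?nF.2 ?nh.2.
  - exact: (nnM nF nh).1.
  - exact: (nn_charfun mG).1.
  apply: filterS h1 => x hx _; rewrite /charfun !indicE.
  case: (boolP (x \in F)) => [/set_mem xF|_]; last by rewrite mul0e lee_fin.
  rewrite mul1e; have [->|hx0] := eqVneq (h x) 0; first by rewrite lee_fin.
  by rewrite mem_set //; split=> //=; rewrite lt_neqAle eq_sym hx0 nh.2.
move=> /(lt_le_trans ltp) /ltW rG.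
rewrite Er (_ : r%:E = 2%:E * (r / 2)%:E); last by rewrite -EFinM; congr EFin; field.
by rewrite lee_wpmul2l // lee_fin.
Qed.

Lemma lim_sup_set_cvg_indic (G : nat -> set S) : (forall k, measurable (G k)) ->
  \sum_(k <oo) mu (G k) < +oo ->
  {ae mu, forall x, (\1_(G k) x : R) @[k --> \oo] --> (0 : R)%R}.
Proof.
move=> mG Gfin; exists (lim_sup_set G); split.
- by apply: bigcap_measurable => // k _; exact: bigcup_measurable.
- exact: lim_sup_set_cvg0.
move=> x /=; apply: contra_notP => xG.
have [k kG] : exists k, ~ (\bigcup_(j >= k) G j) x.
  by apply: contrapT => noe; apply: xG => k _; apply: contrapT => kG; apply: noe; exists k.
apply: cvg_near_cst; exists k => // j /= kj.
by rewrite indicE memNset // => Gx; apply: kG; exists j.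
Qed.

(** If this failed, sets [E k] of measure at most [2^-k] would have norms bounded
    below.  Up to a factor [2] they can be replaced by sets [G k] contained in a
    superlevel set of [f].  By Borel--Cantelli their indicators tend to [0]
    almost everywhere, and the absolute continuity of the norm of [f]
    contradicts the lower bound. *)
Lemma ac_small_sets f : ac_subspace mu N f -> N f != 0 ->
  forall e : R, (0 < e)%R -> exists2 delta : R, (0 < delta)%R &
    forall E, measurable E -> mu E <= delta%:E -> nrm N (charfun E) <= e%:E.
Proof.
move=> [[mf Nf] acf] Nf0 e e0.
have nf := nn_excabs mf; set u := excabsfun f in nf.
have [c c0 uc] : exists2 c : R, (0 < c)%R & 0 < distr mu u c.
  apply: contrapT => noc; move/negP: Nf0; apply; rewrite (nrmE HN) //; apply/eqP.
  apply: nrm_eq0_ae => // s s0; apply/eqP; rewrite eq_le measure_ge0 andbT leNgt.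
  by apply/negP => us; apply: noc; exists s.
pose F := [set x | c%:E < u x].
have mF : measurable F by exact: measurable_gt.
apply: contrapT => nodelta.
have [a a0 aF] : exists2 a : R, (0 < a)%R & a%:E <= mu F.
  move: uc; rewrite /distr -/F; case: (mu F) => [r| |//]; rewrite ?lte_fin => r0.
    by exists r.
  by exists 1%R => //; rewrite leey.
have p2 k : (0 < 1 / (2 ^ k.+1)%:R :> R)%R by rewrite divr_gt0 // ltr0n expn_gt0.
pose delta k : R := (Num.min a (1 / (2 ^ k.+1)%:R))%R.
have delta0 k : (0 < delta k)%R by rewrite lt_min a0 p2.
have : forall k, exists G, [/\ measurable G, G `<=` F, mu G <= (delta k)%:E &
    (e / 2)%:E <= nrm N (charfun G)].
  move=> k; have [E [mE Ed Ee]] : exists E, [/\ measurable E, mu E <= (delta k)%:E &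
      e%:E < nrm N (charfun E)].
    apply: contrapT => noE; apply: nodelta; exists (delta k) => // E mE Ed.
    by rewrite leNgt; apply/negP => eE; apply: noE; exists E.
  have E0 : 0 < mu E.
    rewrite lt_neqAle measure_ge0 andbT; apply/negP => /eqP E0.
    have := @nrm_charfun_le _ _ _ mu N Hres HN HRI 1 E set0 (lexx _) mE measurable0.
    rewrite -E0 measure0 mule0 nrm_set0 mule0 => /(_ (lexx _)).
    by rewrite leNgt (lt_trans _ Ee).
  have EF : mu E <= mu F.
    by rewrite (le_trans _ aF) // (le_trans Ed) // lee_fin ge_min lexx.
  have Efin : 0 < mu E < +oo by rewrite E0 (le_lt_trans Ed) // ltry.
  have [G [mG GF GE EG]] := equimeasurable_subset mF mE Efin EF.
  exists G; split=> //; first exact: le_trans Ed.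
  have := @nrm_charfun_le _ _ _ mu N Hres HN HRI 2 E G _ mE mG EG.
  rewrite ler1n => /(_ isT) /(lt_le_trans Ee) /ltW.
  by rewrite EFinM muleC lee_pdivrMr // muleC.
move=> /choice[G GP].
have mG k : measurable (G k) by have [] := GP k.
have sumG : \sum_(k <oo) mu (G k) < +oo.
  apply: (@le_lt_trans _ _ 1%:E); last exact: ltry.
  apply: le_trans (epsilon_trick0 xpredT ler01); apply: lee_nneseries => // k _.
  by have [_ _ Gd _] := GP k; rewrite (le_trans Gd) // lee_fin ge_min lexx orbT.
have := acf G mG (lim_sup_set_cvg_indic mG sumG).
have ce : (0 < c * (e / 2))%R by rewrite mulr_gt0 // divr_gt0.
move=> /fine_cvgP[fin_near].
move=> /cvgrPdist_lt/(_ _ ce) near_lt.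
have [k [Nfin Nlt]] : exists k, N (excrestr f (G k)) \is a fin_num /\
    (`|0 - fine (N (excrestr f (G k)))| < c * (e / 2))%R.
  have [k1 _ H1] := fin_near; have [k2 _ H2] := near_lt.
  by exists (maxn k1 k2); split; [apply: H1|apply: H2]; rewrite /= ?leq_maxl ?leq_maxr.
have [_ GF _ Ge] := GP k.
have nG : nnmeasurable (charfun (G k) : S -> \bar R) by exact: nn_charfun.
have : c%:E * nrm N (charfun (G k)) <= N (excrestr f (G k)).
  rewrite nrm_restr // -(nrmZ HN (ltW c0)) //.
  apply: (nrm_le HN); [by apply: nnZ => //; exact: ltW|exact: nnM|].
  move=> x; rewrite /charfun indicE; case: (boolP (x \in G k)) => [/set_mem /GF xF|_].
    by rewrite !mule1 ltW.
  by rewrite !mule0.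
rewrite -(fineK Nfin) leNgt => /negP; apply.
apply: (@lt_le_trans _ _ (c * (e / 2))%:E).
  by rewrite lte_fin (le_lt_trans _ Nlt) // sub0r normrN ler_norm.
by rewrite EFinM lee_wpmul2l // lee_fin ltW.
Qed.

End smallness.

(** * Small functions with bounded integral *)
Section small_functions.
Context {R : realType} {d : measure_display} {S : measurableType d}.
Variables (mu : {measure set S -> \bar R}) (N : (S -> excomplex R) -> \bar R).
Hypotheses (Hres : resonant mu) (HN : banach_function_norm mu N).
Hypothesis HRI : rearrangement_invariant mu N.
Hypothesis HACR : ACR mu (associate_norm mu N).
Implicit Types (f : S -> excomplex R) (u v w : S -> \bar R) (E F G : set S).
Local Open Scope ereal_scope.

Lemma dual_ball_associate w : dual_ball mu N w ->
  bfspace (associate_norm mu N) (excnnfun w).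
Proof.
move=> [nw dw]; split; first exact: excmeasurable_nn.
apply: (@le_lt_trans _ _ 1); last exact: ltry.
apply: ge_ereal_sup => _ [g [mg g1] <-].
rewrite abs_pairingE (excabsfun_nn nw.2) pairingC; apply: dw; first exact: nn_excabs.
by rewrite -(nrmE HN).
Qed.

(** Uniform control of the superlevel sets of the dual ball.  On a space of
    infinite measure, if they had arbitrarily large measure then, for every
    [E] of finite measure, [s] times the indicator of [E] would have a
    rearrangement below that of a member of the dual ball, so that the constant
    [s] would itself belong to the dual ball. *)
Lemma dual_ball_distr_bounded (s : R) : (0 < s)%R -> exists E0, [/\ measurable E0, mu E0 < +oo &
  forall w, dual_ball mu N w -> distr mu w s <= mu E0].
Proof.
move=> s0; have [Soo|Sfin] := eqVneq (mu setT) +oo; last first.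
  exists setT; split=> //; first by rewrite lt_neqAle Sfin leey.
  by move=> w [nw _]; apply: le_measure; rewrite ?inE //; exact: measurable_gt.
apply: contrapT => noE0.
have exw E0 : measurable E0 -> mu E0 < +oo ->
    exists w, dual_ball mu N w /\ mu E0 < distr mu w s.
  move=> mE0 E0fin; apply: contrapT => now_; apply: noE0; exists E0; split=> // w dw.
  by rewrite leNgt; apply/negP => lw; apply: now_; exists w.
have /sigma_finiteP[F [FT ndF Fm]] := Hres.1.
have Fx x : exists k, F k x by have : [set: S] x by []; rewrite FT => -[k _ ?]; exists k.
have ncs : nnmeasurable (fun _ : S => s%:E) by apply: nn_cst; rewrite lee_fin ltW.
(* the constant s would belong to the associate space, against (ACR) *)
have ds : dual_ball mu N (fun=> s%:E).
  split=> // v nv v1; rewrite pairingC.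
  have nF k : nnmeasurable (fun x => s%:E * charfun (F k) x).
    by apply: nnZ; [exact: ltW|apply: nn_charfun; exact: (Fm k).1].
  apply: (pairing_le_lim (u_ := fun k x => s%:E * charfun (F k) x)) => //.
  - move=> x i j ij; rewrite lee_wpmul2l ?lee_fin ?(ltW s0) // !indicE.
    case: (boolP (x \in F i)) => // /set_mem xF; rewrite mem_set //.
    by have /subsetPset := ndF _ _ ij; apply.
  - move=> x _; have [k Fkx] := Fx x; apply: cvg_near_cst; exists k => // j /= kj.
    rewrite /charfun indicE mem_set ?mule1 //.
    by have /subsetPset := ndF _ _ kj; apply.
  move=> k; have [w [dw Fw]] := exw _ (Fm k).1 (Fm k).2.
  apply: (le_trans (hardy_littlewood Hres (nF k) nv)).
  apply: (@le_trans _ _ (rpair mu w v)); last first.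
    by rewrite rpairC; apply: le_trans v1; exact: (rpair_le_nrm Hres HN HRI).
  apply: rpair_le => // t t0; rewrite -[X in rear mu w X]divr1; apply: rear_dilate => // r r0.
  rewrite mul1e; have [rs|sr] := ltP r s.
    apply: (@le_trans _ _ (distr mu w s)); last by apply: distr_le (ltW rs); exact: dw.1.
    apply: ltW; apply: le_lt_trans Fw; apply: le_measure; rewrite ?inE.
    - exact: measurable_gt.
    - exact: (Fm k).1.
    move=> x /=; rewrite /charfun indicE; case: (boolP (x \in F k)) => [/set_mem //|_].
    by rewrite mule0 lte_fin ltNge r0.
  rewrite /distr (_ : [set x | _] = set0) ?measure0 //.
  apply/seteqP; split => x //=; rewrite /charfun indicE -EFinM lte_fin ltNge => /negP; apply.
  by rewrite (le_trans _ sr) // ler_piMr ?(ltW s0) //; case: (_ \in _) => /=; rewrite ?lexx ?ler01.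
have s20 : (0 < s / 2)%R by rewrite divr_gt0.
have := HACR (dual_ball_associate ds).
move=> /fine_cvgP[_] /cvgrPdist_lt/(_ _ s0) [B [_ HB]].
have := HB (Num.max B 0 + 1)%R.
have -> : (B < Num.max B 0 + 1)%R by rewrite ltr_pwDr // le_max lexx.
have lo : s%:E <= rear mu (fun=> s%:E) (Num.max B 0 + 1)%R.
  apply: (@rear_lower _ _ _ _ _ _ (Num.max B 0 + 2)%R); last by rewrite ltrD2l; lra.
  move=> r /andP[r0 rs]; rewrite /distr (_ : [set x | _] = setT) ?Soo ?leey //.
  by apply/seteqP; split => x //= _; rewrite lte_fin.
have hi : rear mu (fun=> s%:E) (Num.max B 0 + 1)%R <= s%:E.
  apply/rear_leP => //; first exact: ltW.
  rewrite /distr (_ : [set x | _] = set0) ?measure0 ?lee_fin ?addr_ge0 ?le_max ?lexx ?orbT //.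
  by apply/seteqP; split => x //=; rewrite ltxx.
move=> /(_ isT) /=; rewrite rearrangementE (excabsfun_nn ncs.2).
have -> : rear mu (fun=> s%:E) (Num.max B 0 + 1)%R = s%:E by apply/eqP; rewrite eq_le hi lo.
by rewrite sub0r normrN /= gtr0_norm // ltxx.
Qed.

(** Split the pairing with [w] of the dual ball at the level [s] of [w]: below
    [s] it is at most [s * K]; above, [u <= eps] leaves [eps] times the norm of
    the indicator of a set whose measure is bounded independently of [w]. *)
Lemma nrm_small_functions (e K : R) : (0 < e)%R -> (0 <= K)%R -> exists2 eps : R, (0 < eps)%R &
  forall u, nnmeasurable u -> (forall x, u x <= eps%:E) -> \int[mu]_x u x <= K%:E ->
    nrm N u <= e%:E.
Proof.
move=> e0 K0; pose s : R := (e / (2 * (K + 1)))%R.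
have K1 : (0 < K + 1)%R by rewrite ltr_wpDl.
have s0 : (0 < s)%R by rewrite divr_gt0 // mulr_gt0.
have [E0 [mE0 E0fin dE0]] := dual_ball_distr_bounded s0.
have nE0 : nnmeasurable (charfun E0 : S -> \bar R) by exact: nn_charfun.
have Q0 := nrm_ge0 HN nE0; have Qfin : nrm N (charfun E0) < +oo by exact: (bfn_charfun HN).
have /fineK QE : nrm N (charfun E0) \is a fin_num by rewrite ge0_fin_numE.
set Q := fine _ in QE; have Qge0 : (0 <= Q)%R by rewrite fine_ge0.
have Q1 : (0 < Q + 1)%R by rewrite ltr_wpDl.
pose eps : R := (e / (2 * (Q + 1)))%R.
have eps0 : (0 < eps)%R by rewrite divr_gt0 // mulr_gt0.
exists eps => // u nu ueps uK.
apply: (nrm_le_dual HN Hres.1) => //; first by rewrite lee_fin ltW.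
move=> w dw; have nw := dw.1.
pose G := [set x | s%:E < w x].
have mG : measurable G by exact: measurable_gt.
have nG : nnmeasurable (charfun G : S -> \bar R) by exact: nn_charfun.
have nGw := nnM nG nw; have s0' := ltW s0; have eps0' := ltW eps0.
apply: (@le_trans _ _ (\int[mu]_x (eps%:E * (charfun G x * w x) + s%:E * u x))).
  apply: ge0_le_integral => //.
  - by move=> x _; rewrite mule_ge0 ?nu.2 ?nw.2.
  - exact: (nnM nu nw).1.
  - exact: (nnD (nnZ eps0' nGw) (nnZ s0' nu)).1.
  move=> x _; rewrite /charfun indicE; case: (boolP (x \in G)) => [_|xG].
    rewrite mul1e -[leLHS]adde0; apply: leeD; first by rewrite lee_wpmul2r ?nw.2.
    by rewrite mule_ge0 ?nu.2.
  rewrite mul0e mule0 add0e muleC lee_wpmul2r ?nu.2 // leNgt.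
  by apply: contra xG => sw; rewrite inE.
rewrite ge0_integralD //; last 4 first.
- by move=> x _; exact: (nnZ eps0' nGw).2.
- exact: (nnZ eps0' nGw).1.
- by move=> x _; exact: (nnZ s0' nu).2.
- exact: (nnZ s0' nu).1.
rewrite ge0_integralZl //; [|exact: nGw.1|by move=> x _; exact: nGw.2].
rewrite ge0_integralZl //; [|exact: nu.1|by move=> x _; exact: nu.2].
have GQ : \int[mu]_x (charfun G x * w x) <= Q%:E.
  apply: (le_trans (pairing_le_nrm HN nG dw)); rewrite QE -[leRHS]mul1e.
  by apply: (nrm_charfun_le Hres HN HRI) => //; rewrite mul1e; exact: dE0.
apply: (@le_trans _ _ (eps%:E * Q%:E + s%:E * K%:E)).
  by apply: leeD; apply: lee_wpmul2l.
rewrite -!EFinM -EFinD lee_fin /eps /s.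
have h1 : (e / (2 * (Q + 1)) * Q <= e / 2)%R.
  rewrite invfM mulrA -[leLHS]mulrA ler_piMr ?divr_ge0 ?(ltW e0) //.
  by rewrite mulrC ler_pdivrMr // mul1r lerDl.
have h2 : (e / (2 * (K + 1)) * K <= e / 2)%R.
  rewrite invfM mulrA -[leLHS]mulrA ler_piMr ?divr_ge0 ?(ltW e0) //.
  by rewrite mulrC ler_pdivrMr // mul1r lerDl.
lra.
Qed.

End small_functions.

(** * Cesaro means of a power-measure-bounded map *)
Section cesaro.
Context {R : realType} {d : measure_display} {S : measurableType d}.
Variables (mu : {measure set S -> \bar R}) (phi : S -> S) (C : R).
Hypotheses (mphi : measurable_fun [set: S] phi) (C1 : (1 <= C)%R).
Hypothesis phiC : forall i E, measurable E -> (mu (iter i phi @^-1` E) <= C%:E * mu E)%E.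
Implicit Types (f g : S -> excomplex R) (u v w : S -> \bar R) (E F G : set S).
Local Open Scope ereal_scope.

Lemma measurable_iter i : measurable_fun [set: S] (iter i phi).
Proof.
elim: i => [|i IH]; first exact: measurable_id.
exact: (measurableT_comp mphi IH).
Qed.

Lemma measurable_preimage_iter i E : measurable E -> measurable (iter i phi @^-1` E).
Proof. by move=> mE; rewrite -[X in measurable X]setTI; exact: measurable_iter. Qed.

Lemma iter_composition i f x : iter i (composition_operator phi) f x = f (iter i phi x).
Proof. by elim: i f x => [|i IH] f x //; rewrite iterSr IH /= -iterS. Qed.

Lemma cesaro_meanE n f x : cesaro_mean phi n f x =
  excmul (excfin (n%:R^-1)%R) (\sum_(i < n) f (iter i phi x))%R.
Proof.
rewrite /cesaro_mean /excscalefun; congr excmul.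
by apply: eq_bigr => i _; exact: iter_composition.
Qed.

Lemma excmeasurable_cesaro n f : excmeasurable f -> excmeasurable (cesaro_mean phi n f).
Proof.
move=> mf; rewrite (_ : cesaro_mean phi n f = excscalefun (n%:R^-1)%R
    (fun x => \sum_(i < n) f (iter i phi x))%R); last first.
  by apply/funext => x; rewrite cesaro_meanE.
apply: excmeasurableZ; apply: (excmeasurable_sum (index_enum 'I_n)) => i.
by apply: (excmeasurable_comp (phi := iter i phi)) => //; exact: measurable_iter.
Qed.

Lemma cesaro_meanD n f g h : (forall x, f x = (g x + h x)%R) ->
  forall x, cesaro_mean phi n f x = (cesaro_mean phi n g x + cesaro_mean phi n h x)%R.
Proof.
move=> fgh x; rewrite !cesaro_meanE -excmulDr -big_split; congr (excmul _ _).
by apply: eq_bigr => i _.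
Qed.

(** The Cesaro mean for nonnegative functions, which dominates the modulus of
    the complex one. *)
Definition average n u x : \bar R := (n%:R^-1)%:E * \sum_(i < n) u (iter i phi x).

Lemma le_average (n : nat) (a : 'I_n -> \bar R) (c : R) : (0 <= c)%R ->
  (forall i, 0 <= a i) -> (forall i, a i <= c%:E) -> (n%:R^-1)%:E * \sum_(i < n) a i <= c%:E.
Proof.
move=> c0 a0 ac; apply: (@le_trans _ _ ((n%:R^-1)%:E * \sum_(i < n) c%:E)).
  by rewrite lee_wpmul2l ?lee_fin ?invr_ge0 //; exact: lee_sum.
rewrite sumEFin -EFinM lee_fin sumr_const card_ord -[(c *+ n)%R]mulr_natl mulrA.
have [->|n0] := eqVneq n 0%N; first by rewrite mulr0 mul0r.
by rewrite mulVf ?mul1r // pnatr_eq0.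
Qed.

Lemma nn_comp_iter i u : nnmeasurable u -> nnmeasurable (fun x => u (iter i phi x)).
Proof. by move=> nu; apply: (nn_comp (phi := iter i phi)) => //; exact: measurable_iter. Qed.

Lemma nn_average n u : nnmeasurable u -> nnmeasurable (average n u).
Proof.
move=> nu; apply: nnZ; first by rewrite invr_ge0.
by apply: (nn_sum (index_enum 'I_n)) => i; exact: nn_comp_iter.
Qed.

Lemma excabs_sum (I : Type) (s : seq I) (F : I -> excomplex R) :
  excabs (\sum_(i <- s) F i)%R <= \sum_(i <- s) excabs (F i).
Proof.
elim: s => [|i s IH]; first by rewrite !big_nil excabs_real normr0.
by rewrite !big_cons (le_trans (le_excabsD _ _)) // leeD2l.
Qed.

Lemma excabs_cesaro n f x :
  excabsfun (cesaro_mean phi n f) x <= average n (excabsfun f) x.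
Proof.
rewrite /excabsfun /= cesaro_meanE excabsM excabs_nat /average.
by apply: lee_wpmul2l; [rewrite lee_fin invr_ge0|exact: excabs_sum].
Qed.

Lemma distr_iter i u (s : R) : nnmeasurable u ->
  distr mu (fun x => u (iter i phi x)) s <= C%:E * distr mu u s.
Proof. by move=> nu; exact: (phiC i (measurable_gt s nu)). Qed.

Lemma integral_average_indic n F : measurable F -> mu F < +oo ->
  \int[mu]_x average n (charfun F) x <= (C * fine (mu F))%:E.
Proof.
move=> mF Ffin; have nF : nnmeasurable (charfun F : S -> \bar R) by exact: nn_charfun.
have nFi i := nn_comp_iter i nF.
have FE : mu F = (fine (mu F))%:E by rewrite fineK // ge0_fin_numE.
have C0 : (0 <= C)%R by rewrite (le_trans _ C1).
rewrite ge0_integralZl ?lee_fin ?invr_ge0 //; last 2 first.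
- by apply: emeasurable_sum => i; exact: (nFi i).1.
- by move=> x _; apply: sume_ge0 => i _; exact: (nFi i).2.
rewrite ge0_integral_sum //; last 2 first.
- by move=> i; exact: (nFi i).1.
- by move=> i x _; exact: (nFi i).2.
apply: (@le_average n (fun i : 'I_n => \int[mu]_x charfun F (iter i phi x))).
- by rewrite mulr_ge0 // fine_ge0.
- by move=> i; apply: integral_ge0 => x _; exact: (nFi i).2.
move=> i; rewrite EFinM -FE; apply: le_trans (phiC i mF).
have := integral_indic mu measurableT (measurable_preimage_iter i mF).
rewrite setIT => <-; apply: ge0_le_integral => //.
- by move=> x _; exact: (nFi i).2.
- exact: (nFi i).1.
- exact: (nn_charfun (measurable_preimage_iter i mF)).1.
Qed.

Variable N : (S -> excomplex R) -> \bar R.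
Hypotheses (Hres : resonant mu) (HN : banach_function_norm mu N).
Hypothesis HRI : rearrangement_invariant mu N.

Lemma nrm_average n u : nnmeasurable u -> nrm N (average n u) <= C%:E * nrm N u.
Proof.
move=> nu; have nui i := nn_comp_iter i nu.
have C0 : (0 < C)%R by rewrite (lt_le_trans _ C1).
have := nrm_ge0 HN nu; case E : (nrm N u) => [r| |] // r0; last first.
  by rewrite gt0_muley ?leey // lte_fin.
rewrite lee_fin in r0.
rewrite (nrmZ HN) ?invr_ge0 //; last first.
  by apply: (nn_sum (index_enum 'I_n)) => i; exact: nui.
apply: (@le_trans _ _ ((n%:R^-1)%:E * \sum_(i < n) nrm N (fun x => u (iter i phi x)))).
  apply: lee_wpmul2l; first by rewrite lee_fin invr_ge0.
  exact: (nrm_sum HN (index_enum 'I_n)).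
rewrite -EFinM; apply: le_average.
- by rewrite mulr_ge0 // ltW.
- by move=> i; exact: (nrm_ge0 HN).
move=> i; rewrite EFinM -E; apply: (nrm_distr Hres HN HRI) => //.
by move=> s s0; exact: distr_iter.
Qed.

Lemma nrm_cesaro n f : excmeasurable f ->
  nrm N (excabsfun (cesaro_mean phi n f)) <= C%:E * nrm N (excabsfun f).
Proof.
move=> mf; apply: le_trans (nrm_average n (nn_excabs mf)); apply: (nrm_le HN).
- exact/nn_excabs/excmeasurable_cesaro.
- exact/nn_average/nn_excabs.
- exact: excabs_cesaro.
Qed.

End cesaro.

(** * The mean ergodic theorem *)

Lemma ge0_cvge0 {R : realType} (a : nat -> \bar R) : (forall k, (0 <= a k)%E) ->
  (forall e : R, 0 < e -> \forall k \near \oo, (a k <= e%:E)%E) ->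
  a @ \oo --> 0%E.
Proof.
move=> a0 a_small; apply/fine_cvgP; split.
  near=> k; rewrite ge0_fin_numE //; apply: (@le_lt_trans _ _ 1%:E); last exact: ltry.
  by near: k; exact: a_small.
apply/cvgr0Pnorm_le => e e0; near=> k; rewrite /= ger0_norm ?fine_ge0 //.
have ak : (a k <= e%:E)%E by near: k; exact: a_small.
by rewrite -lee_fin fineK // ge0_fin_numE // (le_lt_trans ak) // ltry.
Unshelve. all: by end_near. Qed.

Section ergodic.
Context {R : realType} {d : measure_display} {S : measurableType d}.
Variables (mu : {measure set S -> \bar R}) (N : (S -> excomplex R) -> \bar R).
Hypotheses (Hres : resonant mu) (HN : banach_function_norm mu N).
Hypothesis HRI : rearrangement_invariant mu N.
Hypothesis HACR : ACR mu (associate_norm mu N).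
Implicit Types (f g : S -> excomplex R) (u v w : S -> \bar R) (E F G : set S).
Local Open Scope ereal_scope.

(** On a set of finite measure, almost everywhere convergence to [0] of indicators
    implies convergence of the measures, by continuity from above along the
    tails. *)
Lemma negligible_setI_small (E_ : nat -> set S) G (delta : R) :
  (forall k, measurable (E_ k)) ->
  {ae mu, forall x, (\1_(E_ k) x : R) @[k --> \oo] --> (0 : R)%R} ->
  measurable G -> mu G < +oo -> (0 < delta)%R ->
  \forall k \near \oo, mu (E_ k `&` G) <= delta%:E.
Proof.
move=> mE [Z [mZ Z0 EZ]] mG Gfin delta0.
pose F k := E_ k `&` G.
have mF k : measurable (F k) by exact: measurableI.
have limF0 : mu (lim_sup_set F) = 0.
  have mlim : measurable (lim_sup_set F).
    by apply: bigcap_measurable => // k _; exact: bigcup_measurable.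
  apply/negligibleP => //; exists Z; split => // x limx; apply: EZ => /= cv.
  have /cvgrPdist_lt/(_ _ ltr01) [k _ Hk] := cv.
  have [j /= kj [Ex _]] := limx k I.
  by have := Hk j kj; rewrite /= indicE mem_set // sub0r normrN normr1 ltxx.
have Ffin : mu (\bigcup_(k >= 0) F k) < +oo.
  apply: le_lt_trans Gfin; apply: le_measure; rewrite ?inE //.
    exact: bigcup_measurable.
  by move=> x [k _ []].
have := lim_sup_set_cvg mu F mF Ffin; rewrite limF0 => /fine_cvgP[fin_near].
move=> /cvgrPdist_lt/(_ _ delta0) lt_near; near=> k.
apply: (@le_trans _ _ (mu (\bigcup_(j >= k) F j))).
  apply: le_measure; rewrite ?inE; [exact: (mF k)| |by move=> x Fx; exists k => /=].
  by apply: bigcup_measurable => j _; exact: mF.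
have fin : mu (\bigcup_(j >= k) F j) \is a fin_num by near: k.
have : (`|0 - fine (mu (\bigcup_(j >= k) F j))| < delta)%R by near: k.
rewrite sub0r normrN -(fineK fin) lee_fin => /ltW; apply: le_trans.
exact: ler_norm.
Unshelve. all: by end_near. Qed.

(** Every multiple of the indicator of the infinity set is dominated by [f]. *)
Lemma bfspace_ae_finite f : bfspace N f -> mu [set x | f x = excinfty] = 0.
Proof.
move=> [mf Nf]; have nf := nn_excabs mf; pose Z := [set x | f x = excinfty].
have mZ : measurable Z by case: mf.
have nZ : nnmeasurable (charfun Z : S -> \bar R) by exact: nn_charfun.
have cZ c : (0 <= c)%R -> c%:E * nrm N (charfun Z) <= nrm N (excabsfun f).
  move=> c0; rewrite -(nrmZ HN) //; apply: (nrm_le HN) => //; first exact: nnZ.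
  move=> x; rewrite /charfun indicE; case: (boolP (x \in Z)) => [|_].
    by rewrite inE /Z /excabsfun /= => ->; rewrite leey.
  by rewrite mule0 nf.2.
have : nrm N (charfun Z) = 0.
  apply/eqP; rewrite eq_le (nrm_ge0 HN) // andbT leNgt; apply/negP => Z0.
  move: Nf; rewrite (nrmE HN) //; have := nrm_ge0 HN nf.
  case E : (nrm N (excabsfun f)) => [r| |] // r0 _.
  case E' : (nrm N (charfun Z)) Z0 => [q| |//]; last first.
    by have := cZ 1%R ler01; rewrite E E' mul1e leye_eq.
  rewrite lte_fin => q0; have := cZ ((r + 1) / q)%R.
  rewrite lee_fin in r0; rewrite E E' -EFinM lee_fin divfK ?gt_eqF //.
  have -> : (0 <= (r + 1) / q)%R by rewrite divr_ge0 ?addr_ge0 // ltW.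
  by move=> /(_ isT); rewrite -subr_ge0 opprD addrA subrr sub0r oppr_ge0 leNgt ltr01.
move=> /(bfn_eq0 HN nZ) [A [mA A0 ZA]]; apply/negligibleP => //; exists A; split=> // x Zx.
by apply: ZA => /=; rewrite /charfun indicE mem_set // => -[] /eqP; rewrite oner_eq0.
Qed.

(** The factor [M] is part of the notion so that it covers, with [M = 0], the case
    of a null function, in which no information on small sets is available. *)
Definition uniformly_small (M : R) : Prop := forall e : R, (0 < e)%R ->
  exists2 delta : R, (0 < delta)%R &
    forall E, measurable E -> mu E <= delta%:E -> M%:E * nrm N (charfun E) <= e%:E.

(** Outside the sets where [f] is at most [k], intersected with an exhaustion by
    sets of finite measure, indicators tend to [0] almost everywhere. *)
Lemma ac_truncation f (e : R) : ac_subspace mu N f -> (0 < e)%R ->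
  exists F M, [/\ measurable F /\ mu F < +oo, (0 <= M)%R,
    forall x, F x -> excabsfun f x <= M%:E,
    N (excrestr f (~` F)) <= e%:E & uniformly_small M].
Proof.
move=> acf e0; have [[mf Nf] lim_f] := acf; have nf := nn_excabs mf.
have [N0|Nn0] := eqVneq (N f) 0.
  exists set0, 0%R; split=> //; first by rewrite measure0 ltry.
    rewrite setC0 (nrm_restr HN) //; apply: (@le_trans _ _ (nrm N (excabsfun f))).
      apply: (nrm_le HN) => //; first by apply: nnM => //; exact: nn_charfun.
      by move=> x; rewrite /charfun indicE in_setT mule1.
    by rewrite -(nrmE HN) // N0 lee_fin ltW.
  by move=> e' e'0; exists 1%R => // E _ _; rewrite mul0e lee_fin ltW.
have /sigma_finiteP[K [KT ndK Km]] := Hres.1.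
pose F k := [set x | excabsfun f x <= k%:R%:E] `&` K k.
have mF k : measurable (F k).
  apply: measurableI; last exact: (Km k).1.
  by have := emeasurable_fun_infty_c measurableT nf.1 k%:R%:E; rewrite setTI.
have Fc0 : {ae mu, forall x, (\1_(~` F k) x : R) @[k --> \oo] --> (0 : R)%R}.
  exists [set x | f x = excinfty]; split.
  - by case: mf.
  - exact: bfspace_ae_finite.
  move=> x /=; apply: contra_notP => fx.
  have [k0 Kx] : exists k, K k x by have : [set: S] x by []; rewrite KT => -[k _ ?]; exists k.
  have ffin : excabsfun f x \is a fin_num by move: fx; rewrite /excabsfun /=; case: (f x).
  apply: cvg_near_cst; near=> k; rewrite indicE memNset //=; apply; split => /=.
    rewrite -(fineK ffin) lee_fin; near: k; exact: nbhs_infty_ger.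
  have /subsetPset : (K k0 <= K k)%O by apply: ndK; near: k; exact: nbhs_infty_ge.
  by apply.
have := lim_f (fun k => ~` F k) (fun k => measurableC (mF k)) Fc0.
move=> /fine_cvgP[[k1 _ H1]] /cvgrPdist_lt/(_ _ e0) [k2 _ H2].
pose k := maxn k1 k2; exists (F k), k%:R; split => //.
- split=> //; apply: le_lt_trans (Km k).2; apply: le_measure; rewrite ?inE //.
    exact: (Km k).1.
  by move=> x [].
- by move=> x [].
- have fin : N (excrestr f (~` F k)) \is a fin_num by apply: H1; rewrite /= leq_maxl.
  have /ltW : (`|0 - fine (N (excrestr f (~` F k)))| < e)%R by apply: H2; rewrite /= leq_maxr.
  rewrite sub0r normrN => lt_e; rewrite -(fineK fin) lee_fin.
  by apply: le_trans lt_e; exact: ler_norm.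
move=> e' e'0; have k10 : (0 < k%:R + 1 :> R)%R by rewrite ltr_wpDl.
have e'k : (0 < e' / (k%:R + 1))%R by rewrite divr_gt0.
have [delta delta0 Hd] := ac_small_sets Hres HN HRI acf Nn0 e'k.
exists delta => // E mE Ed; apply: (@le_trans _ _ (k%:R%:E * (e' / (k%:R + 1))%:E)).
  by apply: lee_wpmul2l; [rewrite lee_fin|exact: Hd].
rewrite -EFinM lee_fin mulrCA ler_piMr ?(ltW e'0) //.
by rewrite ler_pdivrMr // mul1r lerDl.
Unshelve. all: by end_near. Qed.

Variables (phi : S -> S) (C : R).
Hypotheses (mphi : measurable_fun [set: S] phi) (C1 : (1 <= C)%R).
Hypothesis phiC : forall i E, measurable E -> mu (iter i phi @^-1` E) <= C%:E * mu E.
Variable T : (S -> excomplex R) -> (S -> excomplex R).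
Hypothesis HT : xi_limit_operator mu N phi T.

Local Notation A n f := (cesaro_mean phi n f).
Local Notation dist f g := (excabsfun (excsubfun f g)).

Lemma rpair_mono u u' v : nnmeasurable u -> nnmeasurable u' ->
  (forall x, u x <= u' x) -> rpair mu u v <= rpair mu u' v.
Proof.
move=> nu nu' uu; apply: rpair_le => // t _; rewrite -[X in rear mu u' X]divr1.
by apply: rear_dilate => // s s0; rewrite mul1e; exact: distr_mono.
Qed.

(** Convergence in [xi] in the form used below: a single seminorm at a time. *)
Lemma xi_near f (w : S -> excomplex R) (e : R) : bfspace N f ->
  bfspace (associate_norm mu N) w -> (0 < e)%R ->
  \forall n \near \oo, rpair mu (excabsfun w) (dist (A n f) (T f)) < e%:E.
Proof.
move=> Xf Xw e0; pose U := [set g | bfspace N g /\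
  forall i : 'I_1, rearrangement_pairing mu w (excsubfun g (T f)) < e%:E].
have [_ /(_ U) HU] := HT Xf.
have /HU near_U : xi_nbhs mu N (T f) U by exists 1%N, (fun=> w), e; split.
have {}near_U : \forall n \near \oo, U (A n f) by exact: near_U.
apply: filterS near_U => n [_ /(_ ord0)].
by rewrite rearrangement_pairingE.
Qed.

Lemma positive_finite_set : mu setT = 0 \/
  exists F, [/\ measurable F, mu F < +oo & 0 < mu F].
Proof.
have /sigma_finiteP[K [KT ndK Km]] := Hres.1.
have [[k Kk]|noK] := pselect (exists k, 0 < mu (K k)).
  by right; exists (K k); split=> //; [exact: (Km k).1|exact: (Km k).2].
left; apply/negligibleP => //; rewrite KT; apply: negligible_bigcup => k.
apply/negligibleP; first exact: (Km k).1.
apply/eqP; rewrite eq_le measure_ge0 andbT leNgt; apply/negP => Kk.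
by apply: noK; exists k.
Qed.

(** This is the content of (P5). *)
Lemma associate_charfun F : measurable F -> mu F < +oo ->
  bfspace (associate_norm mu N) (excnnfun (charfun F)).
Proof.
move=> mF Ffin; have nF : nnmeasurable (charfun F : S -> \bar R) by exact: nn_charfun.
split; first exact: excmeasurable_nn.
have [c Hc] := bfn_local_int HN mF Ffin.
apply: (@le_lt_trans _ _ (`|c|%:E)); last exact: ltry.
apply: ge_ereal_sup => _ [g [mg g1] <-].
rewrite abs_pairingE (excabsfun_nn nF.2); have ng := nn_excabs mg.
have -> : pairing mu (charfun F) (excabsfun g) = \int[mu]_(x in F) excabsfun g x.
  rewrite [RHS]integral_mkcond; apply: eq_integral => x _.
  rewrite /patch /charfun indicE; case: (x \in F); by rewrite ?mul1e ?mul0e.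
apply: (le_trans (Hc _ ng)); rewrite -[leRHS]mule1.
have n0 := nrm_ge0 HN ng.
apply: (@le_trans _ _ (`|c|%:E * nrm N (excabsfun g))).
  by apply: lee_wpmul2r => //; rewrite lee_fin ler_norm.
by apply: lee_wpmul2l; rewrite ?lee_fin // -(nrmE HN).
Qed.

Let mA n f : excmeasurable f -> excmeasurable (A n f).
Proof. by move=> mf; exact: excmeasurable_cesaro. Qed.

Let nd f g : excmeasurable f -> excmeasurable g -> nnmeasurable (dist f g).
Proof. by move=> mf mg; apply/nn_excabs/excmeasurableB. Qed.

Lemma cesaro_bounded n g F (M : R) x : (0 <= M)%R ->
  (forall x, excabsfun g x <= M%:E * charfun F x) ->
  excabsfun (A n g) x <= M%:E * average phi n (charfun F) x.
Proof.
move=> M0 gM; apply: le_trans (excabs_cesaro _ _ _ _) _.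
rewrite /average muleCA; apply: lee_wpmul2l; first by rewrite lee_fin invr_ge0.
rewrite ge0_sume_distrr; last by move=> i _; rewrite lee_fin.
by apply: lee_sum => i _; exact: gM.
Qed.

Lemma average_charfun_le1 n F x : average phi n (charfun F) x <= 1%:E :> \bar R.
Proof.
by apply: le_average => // i; rewrite /charfun lee_fin.
Qed.

(** The modulus [H n m] of the difference of two means is at most [2 * M], with
    integral at most [K].  It is split at the level [eps] of
    [nrm_small_functions].  The set where it exceeds [eps] has small measure:
    otherwise the pairing with the indicator of a set [F'] of positive finite
    measure would be at least [eps * min delta (mu F')], against the
    [xi]-convergence of both means to the same limit. *)
Lemma cesaro_cauchy_bounded g F (M e : R) : bfspace N g -> measurable F -> mu F < +oo ->
  (0 <= M)%R -> (forall x, excabsfun g x <= M%:E * charfun F x) -> uniformly_small M ->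
  (0 < e)%R -> exists n0 : nat, forall n m : nat, (n0 <= n)%N -> (n0 <= m)%N ->
    nrm N (dist (A n g) (A m g)) <= e%:E.
Proof.
move=> Xg mF Ffin M0 gM smallM e0; have mg := Xg.1.
have nF : nnmeasurable (charfun F : S -> \bar R) by exact: nn_charfun.
have e2 : (0 < e / 2)%R by rewrite divr_gt0.
have e4 : (0 < e / 4)%R by rewrite divr_gt0.
have C0 : (0 <= C)%R by rewrite (le_trans _ C1).
pose K : R := (2 * (M * (C * fine (mu F))))%R.
have K0 : (0 <= K)%R by rewrite !mulr_ge0 // fine_ge0.
have [eps eps0 Heps] := nrm_small_functions Hres HN HRI HACR e2 K0.
have [delta delta0 Hdelta] := smallM _ e4.
have navg n : nnmeasurable (average phi n (charfun F) : S -> \bar R) by exact: nn_average.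
pose H n m := dist (A n g) (A m g).
have nH n m : nnmeasurable (H n m) by apply: nd; exact: mA.
have Havg n m x : H n m x <=
    M%:E * average phi n (charfun F) x + M%:E * average phi m (charfun F) x.
  apply: (le_trans (le_excabsB _ _)).
  by apply: leeD; exact: cesaro_bounded.
have H2M n m x : H n m x <= (2 * M)%:E.
  apply: (le_trans (Havg n m x)); rewrite mulr2n mulrDl mul1r EFinD.
  by apply: leeD; rewrite -[leRHS]mule1 lee_wpmul2l ?lee_fin // average_charfun_le1.
have intH n m : \int[mu]_x H n m x <= K%:E.
  have nM k := nnZ M0 (navg k).
  apply: (@le_trans _ _ (\int[mu]_x (M%:E * average phi n (charfun F) x +
      M%:E * average phi m (charfun F) x))).
    apply: ge0_le_integral => //.
    - by move=> x _; exact: (nH n m).2.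
    - exact: (nH n m).1.
    - exact: (nnD (nM n) (nM m)).1.
  rewrite ge0_integralD //; [|by move=> x _; exact: (nM n).2|exact: (nM n).1
    |by move=> x _; exact: (nM m).2|exact: (nM m).1].
  have intZ k : \int[mu]_x (M%:E * average phi k (charfun F) x) =
      M%:E * \int[mu]_x average phi k (charfun F) x.
    have [mk k0] := navg k; exact: ge0_integralZl.
  rewrite !intZ.
  rewrite /K mulr2n mulrDl mul1r EFinD EFinM.
  by apply: leeD; apply: lee_wpmul2l; rewrite ?lee_fin //;
    apply: (integral_average_indic mphi C1 phiC).
have [n0 Hn0] : exists n0 : nat, forall n m : nat, (n0 <= n)%N -> (n0 <= m)%N ->
    distr mu (H n m) eps <= delta%:E.
  have [S0|[F' [mF' F'fin F'0]]] := positive_finite_set.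
    exists 0%N => n m _ _; apply: (@le_trans _ _ (mu setT)); last by rewrite S0 lee_fin ltW.
    by apply: le_measure; rewrite ?inE //; exact: measurable_gt.
  have F'E : mu F' = (fine (mu F'))%:E by rewrite fineK // ge0_fin_numE.
  pose t : R := Num.min delta (fine (mu F')).
  have t0 : (0 < t)%R by rewrite lt_min delta0 -lte_fin -F'E.
  have et : (0 < eps * t / 2)%R by rewrite divr_gt0 // mulr_gt0.
  have [n0 _ Hn0] := xi_near Xg (associate_charfun mF' F'fin) et.
  have nF' : nnmeasurable (charfun F' : S -> \bar R) by exact: nn_charfun.
  exists n0 => n m n0n n0m; rewrite leNgt; apply/negP => deltaH.
  have mTg : excmeasurable (T g) := (HT Xg).1.1.
  have Ln := Hn0 n n0n; have Lm := Hn0 m n0m.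
  rewrite /= (excabsfun_nn nF'.2) rpairC in Ln; rewrite /= (excabsfun_nn nF'.2) rpairC in Lm.
  have ub : rpair mu (H n m) (charfun F') < (eps * t)%:E.
    apply: (@le_lt_trans _ _ (rpair mu (dist (A n g) (T g)) (charfun F') +
        rpair mu (dist (A m g) (T g)) (charfun F'))).
      apply: le_trans (rpairD Hres _ _ nF'); try by apply: nd => //; exact: mA.
      apply: rpair_mono => //; first by apply: nnD; apply: nd => //; exact: mA.
      by move=> x; apply: le_trans (excabs_sub_trans _ (T g x) _) _; rewrite leeD2l // excabs_subC.
    have -> : (eps * t)%:E = (eps * t / 2)%:E + (eps * t / 2)%:E.
      by rewrite -EFinD -splitr.
    exact: (lteD Ln Lm).
  move: ub; rewrite ltNge => /negP; apply.
  rewrite -[X in (eps * X)%R](mul1r) mulrA; apply: rpair_lower; rewrite ?(ltW eps0) ?(ltW t0) //.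
    move=> s /andP[s0 seps]; apply: (@le_trans _ _ delta%:E).
      by rewrite lee_fin ge_min lexx.
    by apply: (le_trans (ltW deltaH)); apply: distr_le => //; exact: ltW.
  move=> s /andP[s0 s1]; rewrite distr_charfun // s1 F'E lee_fin.
  by rewrite ge_min lexx orbT.
exists n0 => n m n0n n0m.
pose G := [set x | eps%:E < H n m x].
have mG : measurable G by apply: measurable_gt.
have nG : nnmeasurable (charfun G : S -> \bar R) by exact: nn_charfun.
have nGc : nnmeasurable (charfun (~` G) : S -> \bar R) by apply: nn_charfun; exact: measurableC.
have nHc := nnM (nH n m) nGc.
have M2 : (0 <= 2 * M)%R by rewrite mulr_ge0.
apply: (@le_trans _ _ (nrm N (fun x => (2 * M)%:E * charfun G x + H n m x * charfun (~` G) x))).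
  apply: (nrm_le HN); [exact: nH|exact: (nnD (nnZ M2 nG) nHc)|].
  move=> x; rewrite /charfun !indicE in_setC; case: (x \in G).
    by rewrite mule1 mule0 adde0; exact: H2M.
  by rewrite mule0 mule1 add0e.
apply: (le_trans (nrmD HN (nnZ M2 nG) nHc)).
rewrite (_ : e%:E = (e / 2)%:E + (e / 2)%:E); last by rewrite -EFinD -splitr.
apply: leeD.
  rewrite (nrmZ HN) // EFinM -muleA.
  rewrite (_ : (e / 2)%:E = 2%:E * (e / 4)%:E); last by rewrite -EFinM; congr EFin; field.
  by apply: lee_wpmul2l; [rewrite lee_fin|apply: Hdelta => //; exact: Hn0].
apply: Heps => //.
  move=> x; rewrite /charfun indicE in_setC; case: (boolP (x \in G)) => [_|xG] /=.
    by rewrite mule0 lee_fin ltW.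
  by rewrite mule1 leNgt; apply: contra xG => epsH; rewrite inE.
apply: le_trans (intH n m); apply: ge0_le_integral => //.
- by move=> x _; exact: nHc.2.
- exact: nHc.1.
- exact: (nH n m).1.
move=> x _; rewrite -[leRHS]mule1; apply: lee_wpmul2l; first exact: (nH n m).2.
by rewrite /charfun indicE lee_fin; case: (_ \in _); rewrite ?lexx ?ler01.
Qed.


Lemma excrestr_split f F x : f x = (excrestr f F x + excrestr f (~` F) x)%R.
Proof.
rewrite !excrestrE in_setC; case: (x \in F) => /=; first by rewrite addr0.
by rewrite add0r.
Qed.

(** The remainder is taken of norm [e / C], the loss in [nrm_cesaro] being [C]. *)
Lemma ac_cesaro_split f (e : R) : ac_subspace mu N f -> (0 < e)%R ->
  exists F M g r, [/\ [/\ measurable F, mu F < +oo & (0 <= M)%R],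
    bfspace N g /\ (forall x, excabsfun g x <= M%:E * charfun F x), uniformly_small M,
    excmeasurable r /\ (forall n, nrm N (excabsfun (A n r)) <= e%:E) &
    forall n x, A n f x = (A n g x + A n r x)%R].
Proof.
move=> acf e0; have [[mf Nf] _] := acf; have nf := nn_excabs mf.
have C0 : (0 < C)%R by rewrite (lt_le_trans _ C1).
have eC : (0 < e / C)%R by rewrite divr_gt0.
have [F [M [[mF Ffin] M0 fM Nr smallM]]] := ac_truncation acf eC.
have nF : nnmeasurable (charfun F : S -> \bar R) by exact: nn_charfun.
have mg : excmeasurable (excrestr f F) by exact: excmeasurable_restr.
have mr : excmeasurable (excrestr f (~` F)).
  by apply: excmeasurable_restr => //; exact: measurableC.
exists F, M, (excrestr f F), (excrestr f (~` F)); split=> //.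
- split.
    split=> //; rewrite (nrm_restr HN) //; apply: le_lt_trans Nf; rewrite (nrmE HN) //.
    apply: (nrm_le HN); [exact: nnM|exact: nf|] => x.
    rewrite -[leRHS]mule1; apply: lee_wpmul2l; first exact: nf.2.
    by rewrite /charfun indicE lee_fin; case: (_ \in _); rewrite ?lexx ?ler01.
  move=> x; rewrite excabs_restr /charfun indicE; case: (boolP (x \in F)) => [xF|_].
    by rewrite !mule1; apply: fM; exact: set_mem.
  by rewrite !mule0.
- split=> // n; apply: (le_trans (nrm_cesaro mphi C1 phiC Hres HN HRI n mr)).
  rewrite (_ : e%:E = C%:E * (e / C)%:E).
    by apply: lee_wpmul2l; [rewrite lee_fin ltW|rewrite -(nrmE HN)].
  by rewrite -EFinM mulrCA divff ?mulr1 // gt_eqF.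
by move=> n x; apply: cesaro_meanD => y; exact: excrestr_split.
Qed.

Lemma cesaro_cauchy f (e : R) : ac_subspace mu N f -> (0 < e)%R ->
  exists n0 : nat, forall n m : nat, (n0 <= n)%N -> (n0 <= m)%N ->
    nrm N (dist (A n f) (A m f)) <= e%:E.
Proof.
move=> acf e0; have mf := acf.1.1.
have e2 : (0 < e / 2)%R by rewrite divr_gt0.
have e4 : (0 < e / 4)%R by rewrite divr_gt0.
have [F [M [g [r [[mF Ffin M0] [Xg gM] smallM [mr Nr] Afgr]]]]] := ac_cesaro_split acf e4.
have [n0 Hn0] := cesaro_cauchy_bounded Xg mF Ffin M0 gM smallM e2.
exists n0 => n m n0n n0m; have mg := Xg.1.
have nAr k : nnmeasurable (excabsfun (A k r)) by apply: nn_excabs; exact: mA.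
have ng : nnmeasurable (dist (A n g) (A m g)) by apply: nd; exact: mA.
have nr2 := nnD (nAr n) (nAr m).
apply: (@le_trans _ _ (nrm N (fun x => dist (A n g) (A m g) x +
    (excabsfun (A n r) x + excabsfun (A m r) x)))).
  apply: (nrm_le HN); [by apply: nd; exact: mA|exact: nnD|].
  by move=> x; rewrite /excabsfun /excsubfun /= !Afgr; exact: excabs_subDD.
apply: (le_trans (nrmD HN ng nr2)).
rewrite (_ : e%:E = (e / 2)%:E + ((e / 4)%:E + (e / 4)%:E)); last first.
  by rewrite -!EFinD; congr EFin; field.
apply: leeD; first exact: Hn0.
by apply: (le_trans (nrmD HN (nAr n) (nAr m))); apply: leeD; exact: Nr.
Qed.

(** Lower semicontinuity of the norm for [xi]: in the pairing with a fixed [w]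
    of the dual ball, the m-th mean can be exchanged for [T f] as [m] grows. *)
Lemma cesaro_cvg_norm f (e : R) : ac_subspace mu N f -> (0 < e)%R ->
  exists n0 : nat, forall n : nat, (n0 <= n)%N -> nrm N (dist (A n f) (T f)) <= e%:E.
Proof.
move=> acf e0; have [n0 Hn0] := cesaro_cauchy acf e0.
have [Xf _] := acf; have mf := Xf.1; have mTf : excmeasurable (T f) := (HT Xf).1.1.
exists n0 => n n0n; have nD k : nnmeasurable (dist (A k f) (T f)) by apply: nd => //; exact: mA.
apply: (nrm_le_rpair Hres HN); [exact: nD|by rewrite lee_fin ltW|] => w dw.
have nw := dw.1; apply/lee_addgt0Pr => e' e'0.
have [n1 _ Hn1] := xi_near Xf (dual_ball_associate HN dw) e'0.
pose m := maxn n0 n1.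
have nnm : nnmeasurable (dist (A n f) (A m f)) by apply: nd; exact: mA.
apply: (@le_trans _ _ (rpair mu (dist (A n f) (A m f)) w + rpair mu (dist (A m f) (T f)) w)).
  apply: le_trans (rpairD Hres nnm (nD m) nw).
  apply: rpair_mono; [exact: nD|exact: nnD|].
  by move=> x; exact: excabs_sub_trans.
apply: leeD.
  apply: (le_trans (rpair_le_nrm Hres HN HRI nnm dw)).
  by apply: Hn0 => //; rewrite leq_maxl.
have := Hn1 m; rewrite /= leq_maxr (excabsfun_nn nw.2) rpairC => /(_ isT).
exact: ltW.
Qed.

(** Replace [T f] by a mean of [f], then [f] by a bounded [g] supported by [F]:
    the mean of [g] is carried by the finite union [G] of preimages of [F], on
    which the sets [E_ k] eventually have small measure. *)
Lemma limit_absolutely_continuous f : ac_subspace mu N f -> ac_subspace mu N (T f).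
Proof.
move=> acf; have [Xf _] := acf; have mf := Xf.1; have [XTf _] := HT Xf.
have mTf := XTf.1; split=> // E_ mE E0.
apply: ge0_cvge0 => [k|e e0]; first by apply: (bfn_ge0 HN); exact: excmeasurable_restr.
have e2 : (0 < e / 2)%R by rewrite divr_gt0.
have e4 : (0 < e / 4)%R by rewrite divr_gt0.
have [n Hn] := cesaro_cvg_norm acf e4.
have {}Hn := Hn n (leqnn n).
have [F [M [g [r [[mF Ffin M0] [Xg gM] smallM [mr Nr] Afgr]]]]] := ac_cesaro_split acf e4.
pose G := \big[setU/set0]_(i < n) (iter i phi @^-1` F).
have mFi i : measurable (iter i phi @^-1` F) by exact: measurable_preimage_iter.
have GE : G = \bigcup_(i < n) (iter i phi @^-1` F) by rewrite bigcup_mkord.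
have mG : measurable G by apply: bigsetU_measurable => i _; exact: mFi.
have Gfin : mu G < +oo.
  apply: (le_lt_trans (Boole_inequality mu (fun i _ => mFi i))).
  apply: lte_sum_pinfty => i _; apply: (le_lt_trans (phiC _ mF)).
  by rewrite lte_mul_pinfty // lee_fin (le_trans _ C1).
have [delta delta0 Hdelta] := smallM _ e2.
have := negligible_setI_small mE E0 mG Gfin delta0; apply: filterS => k Ek.
have mEG : measurable (E_ k `&` G) by exact: measurableI.
have nE : nnmeasurable (charfun (E_ k) : S -> \bar R) by exact: nn_charfun.
have nEG : nnmeasurable (charfun (E_ k `&` G) : S -> \bar R) by exact: nn_charfun.
have nTf := nn_excabs mTf.
have nDn : nnmeasurable (dist (A n f) (T f)) by apply: nd => //; exact: mA.
have nAr : nnmeasurable (excabsfun (A n r)) by apply: nn_excabs; exact: mA.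
have nMEG := nnZ M0 nEG.
have AgG x : excabsfun (A n g) x <= M%:E * charfun G x.
  apply: (le_trans (cesaro_bounded n x M0 gM)); apply: lee_wpmul2l; first by rewrite lee_fin.
  rewrite /charfun; case: (boolP (x \in G)) => xG; rewrite indicE.
    by rewrite xG; exact: average_charfun_le1.
  rewrite (negbTE xG) /average big1 ?mule0 // => i _; rewrite /charfun indicE memNset // => Fx.
  by move/negP: xG; apply; rewrite inE GE; exists i => /=.
apply: (@le_trans _ _ (nrm N (fun x => (dist (A n f) (T f) x + excabsfun (A n r) x) +
    M%:E * charfun (E_ k `&` G) x))).
  rewrite (nrm_restr HN) //.
  apply: (nrm_le HN); [exact: nnM|exact: (nnD (nnD nDn nAr) nMEG)|].
  move=> x; have le1 := excabs_le_sub (A n f x) (T f x).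
  rewrite /charfun !indicE in_setI; case: (x \in E_ k); last first.
    by rewrite mule0 andFb mule0 adde0 adde_ge0 ?nDn.2 ?nAr.2.
  rewrite mule1 andTb; apply: (le_trans le1); rewrite -addeA; apply: leeD => //.
  rewrite Afgr addeC; apply: (le_trans (le_excabsD _ _)); apply: leeD => //.
  by have := AgG x; rewrite /charfun indicE.
apply: (le_trans (nrmD HN (nnD nDn nAr) nMEG)).
rewrite (_ : e%:E = ((e / 4)%:E + (e / 4)%:E) + (e / 2)%:E); last first.
  by rewrite -!EFinD; congr EFin; field.
apply: leeD; first by apply: (le_trans (nrmD HN nDn nAr)); apply: leeD.
by rewrite (nrmZ HN) //; exact: Hdelta.
Qed.

End ergodic.

Theorem theorem5p8 (R : realType) (d : measure_display) (S : measurableType d)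
    (mu : {measure set S -> \bar R})
    (N : (S -> excomplex R) -> \bar R)
    (phi : S -> S)
    (T : (S -> excomplex R) -> (S -> excomplex R)) :
  resonant mu ->
  banach_function_norm mu N ->
  rearrangement_invariant mu N ->
  ACR mu N ->
  ACR mu (associate_norm mu N) ->
  power_measure_bounded mu phi ->
  xi_limit_operator mu N phi T ->
  forall f, ac_subspace mu N f ->
    ac_subspace mu N (T f) /\
    N (excsubfun (cesaro_mean phi n f) (T f)) @[n --> \oo] --> 0%E.
Proof.
move=> Hres HN HRI _ HACR [mphi [A [A0 phiA]]] HT f acf.
pose C := Num.max 1 A.
have C1 : 1 <= C by rewrite le_max lexx.
have phiC i E : measurable E -> (mu (iter i phi @^-1` E) <= C%:E * mu E)%E.
  move=> mE; case: i => [|i].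
    by rewrite -[leLHS]mul1e; apply: lee_wpmul2r; rewrite ?lee_fin.
  apply: (le_trans (phiA i.+1 _ E mE)) => //.
  by apply: lee_wpmul2r; rewrite ?lee_fin // le_max lexx orbT.
split; first exact: (limit_absolutely_continuous Hres HN HRI HACR mphi C1 phiC HT acf).
have [Xf _] := acf; have [[mTf _] _] := HT f Xf.
have mD n : excmeasurable (excsubfun (cesaro_mean phi n f) (T f)).
  by apply: excmeasurableB => //; apply: excmeasurable_cesaro => //; exact: Xf.1.
apply: ge0_cvge0 => [n|e e0]; first exact: (bfn_ge0 HN).
have [n0 Hn0] := cesaro_cvg_norm Hres HN HRI HACR mphi C1 phiC HT acf e0.
by exists n0 => // n n0n; rewrite (nrmE HN) //; exact: Hn0.
Qed.
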